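(* Let $T_X^{gH}$ be a canonical deformed gauge group of translations. Let $x,x'\in X$ be two points and let $s\mapsto x(s)$, $x(0)=x$, $x(s)=x'$, be the affinely parametrized geodesic (of the connection $\Gamma$ defined by the group) connecting them, with $\tau_{x(s)}:=h_{x(s)}\langle\dot x(s)\rangle$. Then along this geodesic $$\mu_x(s\tau_x)\langle\tau_x\rangle=\tau_x+s\,\gamma_x\langle\tau_x,\tau_x\rangle,\qquad \lambda_x(s\tau_x)\langle\tau_{x'}\rangle=\tau_x .$$
   Context: All considerations are local: points are taken sufficiently close, so that any two of them are joined by a unique (short) geodesic, and parameters are small. $X$ is an open coordinate domain, regarded as a domain of a finite-dimensional real affine space with translation vector space $\widetilde T$; $T$ is a real vector space isomorphic to $\widetilde T$. A deformation is a family of maps $H_x:\widetilde T\to T$, $x\in X$, smooth in all variables, each a (local, near $0$) diffeomorphism with $H_x(0)=0$; $K_x:=H_x^{-1}$, $h_x:=DH_x(0)$, $k_x:=h_x^{-1}$. The deformed gauge group of translations $T_X^{gH}$ is the (local) group of smooth functions $x\mapsto t_x\in T$ for which $x\mapsto x+K_x(t_x)$ has invertible derivative, with multiplication $(t\times t')_x=\varphi_x(t_x,t'_{x'})$, where $\varphi_x(t,t'):=H_x(K_x(t)+K_{x'}(t'))$, $x'=x+K_x(t)$, and action $x\mapsto x+K_x(t_x)$ on $X$. Auxiliary maps: $\mu_x(t'):=\partial\varphi_x(0,t')$ and $\lambda_x(t):=\partial'\varphi_x(t,0)$ (linear maps $T\to T$), where $\partial,\partial'$ are derivatives in the first and second argument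 of $\varphi_x$. Also $\gamma_x:=\partial\partial'\varphi_x(0,0)$ (first slot of $\gamma_x\langle\cdot,\cdot\rangle$ for the first argument of $\varphi_x$). The group defines on $X$ the torsion-free affine connection with coefficients $\Gamma_x:=k_x\circ D^2H_x(0)$ in the holonomic frame; its affinely parametrized geodesics satisfy $\ddot x+\Gamma_x\langle\dot x,\dot x\rangle=0$. The group (and the deformation $H$) is called canonical if for any two points $x,x'\in X$ there is a smooth parametric curve $x(s)$ through them, starting at $x(0)=x$, such that, with $\tau_{x(s)}:=h_{x(s)}\langle\dot x(s)\rangle$ and $x'=x(s)$, one has $\varphi_x(s\tau_x,s'\tau_{x'})=(s+s')\tau_x$ for all (admissible) $s,s'$. *)

(* Defs.v *)
From HB Require Import structures.
From mathcomp Require Import all_boot all_order all_algebra.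
From mathcomp Require Import all_classical all_reals all_analysis.

Set Implicit Arguments.
Unset Strict Implicit.
Unset Printing Implicit Defensive.

Import Order.TTheory GRing.Theory Num.Theory.
Import numFieldNormedType.Exports.

Local Open Scope classical_set_scope.
Local Open Scope ring_scope.

Section Smooth.
Context {R : realType}.

(* Meant for A open and V finite-dimensional, where continuity of x |-> Df(x)
   is the same as continuity of x |-> Df(x)<v> for each v. *)
Fixpoint Ck_on {V W : normedModType R} (k : nat) (A : set V) (f : V -> W) :
    Prop :=
  match k with
  | 0 => {in A, continuous f}
  | k'.+1 => (forall x, A x -> differentiable f x) /\
             (forall v : V, Ck_on k' A (fun x => 'd f x v))
  end.

Definition smooth_on {V W : normedModType R} (A : set V) (f : V -> W) : Prop :=
  forall k, Ck_on k A f.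

(* 'pinv_(fun=> 0) A f is the inverse of f|A on f @` A, and 0 elsewhere. *)
Definition diffeomorphism_on {V W : normedModType R} (A : set V) (f : V -> W) :
    Prop :=
  [/\ open A /\ open (f @` A), {in A &, injective f}, smooth_on A f &
      smooth_on (f @` A) ('pinv_(fun=> 0) A f)].

End Smooth.

(* In coordinates both the translation space of the affine space containing X
   and the space T of group parameters are 'rV[R]_n.  The map H_x is local:
   it is only considered on the section of dfm_dom at x, an open neighbourhood
   of 0; outside of it the values of dfm_map are irrelevant. *)
Record deformation (R : realType) (n : nat) := Deformation {
  dfm_base : set 'rV[R]_n;
  dfm_dom : set ('rV[R]_n * 'rV[R]_n);
  dfm_map :> 'rV[R]_n -> 'rV[R]_n -> 'rV[R]_n;
  dfm_base_open : open dfm_base;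
  dfm_dom_open : open dfm_dom;
  dfm_dom_base : dfm_dom `<=` dfm_base `*` setT;
  dfm_dom0 : forall x, dfm_base x -> dfm_dom (x, 0);
  dfm_smooth : smooth_on dfm_dom (fun p => dfm_map p.1 p.2);
  dfm_map0 : forall x, dfm_base x -> dfm_map x 0 = 0;
  dfm_diffeo : forall x, dfm_base x ->
    diffeomorphism_on (xsection dfm_dom x) (dfm_map x) }.

Section Deformation.
Context {R : realType} {n : nat}.
Local Notation V := 'rV[R]_n.
Implicit Types (H : deformation R n) (x t a b : V) (J : set R) (c : R -> V).

Definition Kmap H x : V -> V := 'pinv_(fun=> 0) (xsection (dfm_dom H) x) (H x).

Definition Kdom H x : set V := H x @` xsection (dfm_dom H) x.

Definition hmap H x : V -> V := 'd (H x) (0 : V).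

Definition kmap H x : V -> V := 'pinv_(fun=> 0) setT (hmap H x).

Definition translate H x t : V := x + Kmap H x t.

Definition phi H x t t' : V := H x (Kmap H x t + Kmap H (translate H x t) t').

(* the pairs (t, t') for which all the local maps occurring in phi H x t t'
   are evaluated inside their domains *)
Definition phi_dom H x t t' : Prop :=
  [/\ Kdom H x t, Kdom H (translate H x t) t' &
      xsection (dfm_dom H) x (Kmap H x t + Kmap H (translate H x t) t')].

Definition mu H x t' : V -> V := 'd (fun t => phi H x t t') (0 : V).

Definition lambda H x t : V -> V := 'd (phi H x t) (0 : V).

Definition gamma H x a b : V := 'd (fun t => lambda H x t b) (0 : V) a.

(* D^2 H_x(0)<a, b> *)
Definition D2H H x a b : V := 'd (fun u => 'd (H x) u b) (0 : V) a.

Definition Gamma H x a b : V := kmap H x (D2H H x a b).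

Definition curve_in H J c : Prop :=
  [/\ open J, is_interval J, smooth_on J c & forall s, J s -> dfm_base H (c s)].

Definition geodesic H J c : Prop :=
  curve_in H J c /\
  forall s, J s ->
    derive1 (derive1 c) s + Gamma H (c s) (derive1 c s) (derive1 c s) = 0.

Definition tau H c (s : R) : V := hmap H (c s) (derive1 c s).

(* Points of X are close enough to each other for the local map H_x to be
   defined at all differences x' - x; any deformation satisfies this after
   shrinking X around a given point, since dfm_dom is a neighbourhood of
   X x {0}. *)
Definition close_points H : Prop :=
  forall x x', dfm_base H x -> dfm_base H x' -> dfm_dom H (x, x' - x).

Definition canonical_deformation H : Prop :=
  forall x x', dfm_base H x -> dfm_base H x' ->
  exists (J : set R) (c : R -> V),
    [/\ curve_in H J c,
        J 0 /\ c 0 = x,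
        exists2 s1, J s1 & c s1 = x' &
        forall s s', J s -> phi_dom H x (s *: tau H c 0) (s' *: tau H c s) ->
          phi H x (s *: tau H c 0) (s' *: tau H c s) = (s + s') *: tau H c 0].

End Deformation.

(* Main.v *)
(* Call u |-> e(u) = x + K_x(u tau) a ray.  In a canonical group the curve
   through x and x' is a ray, and the canonical relation reads
   phi_x(u tau, s tau_{e(u)}) = (u + s) tau with tau_{e(u)} = h_{e(u)}<e'(u)>.
   Its second derivative in s shows that rays are geodesics, so by uniqueness
   for the geodesic equation the given geodesic is the ray with
   tau = h_x<c'(0)>.  The derivative in s at s = 0 is the formula
   lambda_x(u tau)<tau_{e(u)}> = tau.  Differentiating that in u at 0 gives
   gamma_x<tau, tau> + d = 0, where d is the derivative of tau_{e(u)} at 0,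
   while the derivative of the canonical relation in u at 0 gives
   mu_x(s tau)<tau> + s d = tau.  These derivatives exist because K_y(t) is
   jointly differentiable in (y, t), which is an implicit function argument as
   a deformation is only assumed to have smooth inverses fibrewise. *)
Require Import Defs.
From HB Require Import structures.
From mathcomp Require Import all_boot all_order all_algebra.
From mathcomp Require Import all_classical all_reals all_analysis.
From mathcomp Require Import ring lra.

Set Implicit Arguments.
Unset Strict Implicit.
Unset Printing Implicit Defensive.

Import Order.TTheory GRing.Theory Num.Theory.
Import numFieldNormedType.Exports.

Local Open Scope classical_set_scope.
Local Open Scope ring_scope.

(** * Differential calculus in finite dimension *)

(** Neither comparison with rays solves for the highest derivative. The canonical curve is compared
    through h_y(y') = w(u), and the geodesic through h_y(y'') + D^2H_y<y', y'> = 0, the geodesic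
    equation with h_y applied. A locally uniform lower bound for h_y then does the work of a bound
    on its inverse, and only Lipschitz estimates for derivatives of [Hpair] remain. Being on the ray
    is expressed as H_x(c(u) - x) = u tau. [close_points] makes both sides defined and continuous
    along the whole curve, so agreement is a closed condition; local uniqueness makes it open, and
    connectedness of the parameter interval does the rest. The curve that canonicity supplies for x
    and e(u) has its own initial vector and its own arrival parameter. Once it is known to be a ray,
    its initial vector is a multiple of the given one, and homogeneity in the parameters carries the
    relation over. Since ['d] is available only point by point and on vectors, statements about
    moving linear maps are reduced to finitely many vectors by expanding in a [frame]. *)

Section Differentials.
Context {R : realType}.
Implicit Types U V W : normedModType R.

Lemma is_diff_epsP V W (f : V -> W) (p : V) (df : {linear V -> W}) :
  continuous df ->
  (forall e, 0 < e -> \forall q \near p, `|f q - f p - df (q - p)| <= e * `|q - p|) ->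
  is_diff p f df.
Proof.
move=> cdf fo.
have fE : f \o shift p = cst (f p) + df +o_ 0 id.
  apply/eqaddoP => e e0.
  have := fo e e0.
  rewrite (near_shift 0) subr0; apply: filterS => h /=.
  by rewrite addrK -[X in X - _ - _]/((f \o shift p) h) opprD addrA.
have dE := diff_unique cdf fE.
by apply: DiffDef => //; apply/diff_locallyP; rewrite dE.
Qed.

Lemma differentiable_eps {V W} {f : V -> W} {p : V} : differentiable f p ->
  forall e, 0 < e ->
    \forall q \near p, `|f q - f p - 'd f p (q - p)| <= e * `|q - p|.
Proof.
move=> /diff_locally fE e e0.
rewrite (near_shift 0) subr0.
have /eqaddoP/(_ e e0) := fE; apply: filterS => h /=.
by rewrite addrK opprD addrA.
Qed.

Lemma is_diffE V W (f df : V -> W) (p v : V) : is_diff p f df -> 'd f p v = df v.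
Proof. by move=> fd; rewrite -(@diff_val _ _ _ _ _ _ _ fd). Qed.

Lemma is_diff_unique V W (f df dg : V -> W) (p v : V) :
  is_diff p f df -> is_diff p f dg -> df v = dg v.
Proof. by move=> fd gd; rewrite -(is_diffE v fd) -(is_diffE v gd). Qed.

(** The maps of a deformation are local, so identities such as [Kmap H x (H x z) = z] hold only near
    a point; this is what allows them to be differentiated. *)
Lemma near_eq_is_diff V W (f g : V -> W) (p : V) (df : V -> W) :
  (\forall q \near p, f q = g q) -> is_diff p f df -> is_diff p g df.
Proof.
move=> fg fdf; have dfp : differentiable f p by [].
have dE : 'd f p = df :> (V -> W) by exact: diff_val.
suff gd : is_diff p g ('d f p) by apply: DiffDef => //; rewrite -dE diff_val.
apply: is_diff_epsP; first exact: diff_continuous.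
move=> e e0; have fgp : f p = g p by apply: (nbhs_singleton fg).
near=> q; rewrite -fgp -(near fg q)//; near: q; exact: differentiable_eps.
Unshelve. all: by end_near. Qed.

End Differentials.

(** * Product rules for families of linear maps, through finite coordinates *)

Section Coordinates.
Context {R : realType}.
Implicit Types U V W Z : normedModType R.

Lemma is_diff_sum V W (I : finType) (F dF : I -> V -> W) (p : V) :
  (forall i, is_diff p (F i) (dF i)) ->
  is_diff p (fun q => \sum_i F i q) (fun h => \sum_i dF i h).
Proof.
move=> Fd; rewrite -!fct_sumE; elim/big_rec2 : _ => [|i y1 y2 _ yd].
  exact: is_diff_cst.
exact: is_diffD.
Qed.

Lemma is_diff_scale V W (k : V -> R) (f : V -> W) dk df (p : V) :
  is_diff p k dk -> is_diff p f df ->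
  is_diff p (fun q => k q *: f q) (fun h => dk h *: f p + k p *: df h).
Proof.
move=> kd fd.
have scale_bilin : bilinear_for
    (GRing.Scale.Law.clone _ _ ( *:%R ) _) (GRing.Scale.Law.clone _ _ ( *:%R ) _)
    ((fun (a : R) (w : W) => a *: w) : R -> W -> W).
  split => [u a x y|u a x y] /=; first by rewrite scalerDl scalerA.
  by rewrite scalerDr !scalerA mulrC.
pose sM := bilinear_isBilinear.Build _ _ _ _ _ _ (fun (a : R) (w : W) => a *: w)
  scale_bilin.
pose s : {bilinear R -> W -> W} := HB.pack (fun (a : R) (w : W) => a *: w) sM.
have sc : continuous (fun q : R * W => s q.1 q.2).
  by move=> q; apply: (@cvgZ _ _ _ _ _ fst snd); [exact: cvg_fst|exact: cvg_snd].
have sd : is_diff (k p, f p) (fun q : R * W => s q.1 q.2)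
    (fun q : R * W => s (k p) q.2 + s q.1 (f p)).
  by apply: DiffDef; [exact: differentiable_bilin | rewrite diff_bilin].
have := is_diff_comp (is_diff_pair kd fd) sd.
by move=> /is_diff_eq; apply; rewrite funeqE => h /=; rewrite addrC.
Qed.

(** A witness of finite dimension that serves row vectors and their products alike, since
    derivatives are taken on both. *)
Record frame U := Frame {
  fr_index : finType;
  fr_vec : fr_index -> U;
  fr_coord : fr_index -> {linear U -> R};
  fr_coord_continuous : forall i, continuous (fr_coord i);
  fr_sum : forall v, v = \sum_i fr_coord i v *: fr_vec i }.

Lemma linear_frame U W (b : frame U) (L : {linear U -> W}) (v : U) :
  L v = \sum_(i : fr_index b) fr_coord i v *: L (fr_vec i).
Proof.
rewrite [in LHS](fr_sum b v) linear_sum; apply: eq_bigr => i _.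
by rewrite linearZ.
Qed.

(** Expanding [w z] in the frame turns [L z (w z)] into a finite sum of scalar functions times [L z]
    at fixed vectors, so differentiability of the family vector by vector suffices. *)
Lemma is_diff_linear_family U W Z (b : frame U) (L : Z -> {linear U -> W})
    (w dw : Z -> U) (a : Z) :
  (forall v, differentiable (fun z => L z v) a) -> is_diff a w dw ->
  is_diff a (fun z => L z (w z))
    (fun h => 'd (fun z => L z (w a)) a h + L a (dw h)).
Proof.
move=> Ld wd.
have -> : (fun z => L z (w z)) =
    fun z => \sum_(i : fr_index b) fr_coord i (w z) *: L z (fr_vec i).
  by rewrite funeqE => z; exact: linear_frame.
have cwd (i : fr_index b) : is_diff a (fun z => fr_coord i (w z)) (fr_coord i \o dw).
  apply: (@is_diff_comp _ _ _ _ w dw (fr_coord i)).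
  apply: DiffDef; first exact/linear_differentiable/fr_coord_continuous.
  by rewrite diff_lin //; exact: fr_coord_continuous.
have Ldv (v : U) : is_diff a (fun z => L z v) ('d (fun z => L z v) a).
  exact: differentiableP.
have := is_diff_sum (fun i => is_diff_scale (cwd i) (Ldv (fr_vec i))).
move=> /is_diff_eq; apply; rewrite funeqE => h /=.
rewrite big_split addrC -linear_frame; congr (_ + _).
have dE := is_diff_sum (fun i : fr_index b =>
  is_diffZ (fr_coord i (w a)) (Ldv (fr_vec i))).
rewrite -[LHS](is_diffE h dE).
by congr ('d _ _ _); rewrite funeqE => z; rewrite -linear_frame.
Qed.

(** The preceding rule for the family ['d f (u z)]; it produces the second derivatives that occur
    along rays, in [hmap] and in [lambda]. *)
Lemma is_diff_dapp U W Z (b : frame U) (f : U -> W) (u w du dw : Z -> U) (a : Z) :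
  (forall v, differentiable (fun q => 'd f q v) (u a)) ->
  is_diff a u du -> is_diff a w dw ->
  is_diff a (fun z => 'd f (u z) (w z))
    (fun h => 'd (fun q => 'd f q (w a)) (u a) (du h) + 'd f (u a) (dw h)).
Proof.
move=> fd ud wd.
have fud v : is_diff a (fun z => 'd f (u z) v) ('d (fun q => 'd f q v) (u a) \o du).
  by apply: (@is_diff_comp _ _ _ _ u du (fun q => 'd f q v));
    exact: differentiableP.
have Ld v : differentiable (fun z => 'd f (u z) v) a by have [] := fud v.
have := is_diff_linear_family b (L := fun z => 'd f (u z)) Ld wd.
by move=> /is_diff_eq; apply; rewrite funeqE => h /=; rewrite (is_diffE _ (fud _)).
Qed.

Lemma is_diff_curve_unique U V W (f : R -> W) (A : {linear U -> W})
    (B : {linear V -> W}) a b w (u : R) :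
  is_diff u f (fun h => A (h *: a) + B (h *: b)) ->
  is_diff u f (fun h => h *: w) -> A a + B b = w.
Proof.
move=> fd fd'; have := is_diff_unique (1 : R) fd fd'.
by rewrite !scale1r.
Qed.

Lemma is_diff_line_unique U W (f : R -> W) (A : {linear U -> W}) a w (u : R) :
  is_diff u f (fun h => A (h *: a)) -> is_diff u f (fun h => h *: w) -> A a = w.
Proof.
move=> fd fd'; have := is_diff_unique (1 : R) fd fd'.
by rewrite !scale1r.
Qed.

Lemma rV_norm_coord n (v : 'rV[R]_n) i : `|v ord0 i| <= `|v|.
Proof.
by rewrite [leRHS]/Num.Def.normr/= mx_normrE; exact: (le_bigmax _ _ (ord0, i)).
Qed.

Lemma rV_norm_le n (v : 'rV[R]_n) B :
  0 <= B -> (forall i, `|v ord0 i| <= B) -> `|v| <= B.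
Proof.
move=> B0 vB; rewrite [leLHS]/Num.Def.normr/= mx_normrE bigmax_le// => -[i j] _.
by rewrite [i]ord1; exact: vB.
Qed.

Definition coord_lin n (i : 'I_n) : 'rV[R]_n -> R := fun v => v ord0 i.

Lemma coord_lin_is_linear n (i : 'I_n) : linear (@coord_lin n i).
Proof. by move=> k u v; rewrite /coord_lin !mxE. Qed.

HB.instance Definition _ n (i : 'I_n) :=
  GRing.isLinear.Build R 'rV[R]_n R _ (coord_lin i) (coord_lin_is_linear i).

Definition rV_frame n : frame 'rV[R]_n.
Proof.
apply: (@Frame _ _ (fun i : 'I_n => 'e_i) (fun i => coord_lin i)).
- by move=> i; exact: coord_continuous.
- by move=> v; rewrite [LHS]row_sum_delta.
Defined.

Section ProductFrame.
Variables (U V : normedModType R) (b : frame U) (c : frame V).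

Definition prod_vec (k : fr_index b + fr_index c) : U * V :=
  match k with inl i => (fr_vec i, 0) | inr j => (0, fr_vec j) end.

Definition prod_coord (k : fr_index b + fr_index c) (v : U * V) : R :=
  match k with inl i => fr_coord i v.1 | inr j => fr_coord j v.2 end.

Lemma prod_coord_is_linear k : linear (prod_coord k).
Proof. by case: k => i a u v; rewrite /= linearP. Qed.

HB.instance Definition _ k :=
  GRing.isLinear.Build R (U * V)%type R _ (prod_coord k) (prod_coord_is_linear k).

Lemma prod_coord_continuous k : continuous (prod_coord k).
Proof.
case: k => i v; apply: continuous_comp.
- exact: cvg_fst.
- exact: fr_coord_continuous.
- exact: cvg_snd.
- exact: fr_coord_continuous.
Qed.

Lemma prod_frame_sum (v : U * V) : v = \sum_k prod_coord k v *: prod_vec k.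
Proof.
have fst_sum (J : finType) (F : J -> U * V) : (\sum_k F k).1 = \sum_k (F k).1.
  by apply: (big_morph fst).
have snd_sum (J : finType) (F : J -> U * V) : (\sum_k F k).2 = \sum_k (F k).2.
  by apply: (big_morph snd).
case: v => v w; apply/eqP; rewrite -pair_eqE; apply/andP; split; apply/eqP => /=.
  rewrite fst_sum big_sumType/= [LHS](fr_sum b) [X in _ + X]big1 ?addr0// => j _.
  by rewrite scaler0.
rewrite snd_sum big_sumType/= [LHS](fr_sum c) [X in X + _]big1 ?add0r// => j _.
by rewrite scaler0.
Qed.

Definition prod_frame : frame (U * V)%type :=
  Frame prod_coord_continuous prod_frame_sum.

End ProductFrame.

End Coordinates.

(** * Mean value estimates and strict differentiability *)

Section MeanValue.
Context {R : realType}.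
Implicit Types U V W : normedModType R.

(** In finite dimension pointwise convergence of linear maps is convergence in operator norm: the
    frame vectors control all others. *)
Lemma linear_family_near (T : topologicalType) U W (b : frame U)
    (L : T -> {linear U -> W}) (x0 : T) :
  (forall v, L x v @[x --> x0] --> L x0 v) ->
  forall e, 0 < e -> \forall x \near x0, forall v, `|L x v - L x0 v| <= e * `|v|.
Proof.
move=> Lc e e0.
have /choice[k kP] : forall i : fr_index b, exists k : R,
    0 < k /\ forall v, `|fr_coord i v| <= k * `|v|.
  move=> i; have [k k0 kP] := linear_lipschitz (@fr_coord_continuous _ _ b i).
  by exists k.
have k0 i : 0 < k i by have [] := kP i.
(* The summand 1 keeps [K] positive even when the frame is empty. *)
pose K := 1 + \sum_i k i.
have K0 : 0 < K by rewrite ltr_pwDl// sumr_ge0// => i _; exact: ltW.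
have eK : 0 < e / K by rewrite divr_gt0.
have : \forall x \near x0, forall i : fr_index b, `|L x (fr_vec i) - L x0 (fr_vec i)| <= e / K.
  apply: filter_forall => i.
  have /cvgrPdist_le/(_ _ eK) := Lc (@fr_vec _ _ b i).
  by apply: filterS => x; rewrite distrC.
apply: filterS => x xK v.
rewrite !(linear_frame b (L _)) -sumrB.
apply: le_trans (ler_norm_sum _ _ _) _.
apply: (@le_trans _ _ (\sum_i (k i * `|v|) * (e / K))).
  apply: ler_sum => i _; rewrite -scalerBr normrZ.
  by rewrite ler_pM// (kP i).2.
rewrite -big_distrl -big_distrl/= mulrC mulrA ler_wpM2r// mulrAC.
rewrite ler_pdivrMr// ler_pM2l// /K lerDr//.
Qed.

(** The norm of row vectors is the maximum of the coordinates, so the scalar mean value theorem in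
    each coordinate gives the bound with the same constant. *)
Lemma mvt_norm n (d dd : R -> 'rV[R]_n) (a b B : R) : a <= b ->
  (forall t, a <= t <= b -> is_diff t d (fun h => h *: dd t)) ->
  (forall t, a <= t <= b -> `|dd t| <= B) ->
  `|d b - d a| <= B * (b - a).
Proof.
move=> ab dP dB.
have B0 : 0 <= B by apply: le_trans (dB a _); rewrite ?lexx.
apply: rV_norm_le => [|i]; first by rewrite mulr_ge0// subr_ge0.
have diP t : a <= t <= b -> is_diff t (fun t => d t ord0 i) (fun h => h * dd t ord0 i).
  move=> /dP td; have := is_diff_comp td (differentiableP (differentiable_coord (d t) ord0 i)).
  move=> /is_diff_eq; apply; rewrite funeqE => h /=.
  have cc := @coord_continuous R 1 n ord0 i.
  rewrite -[X in 'd X _ ](_ : (coord_lin i : _ -> _) = _)// diff_lin//=.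
  by rewrite /coord_lin mxE.
have [||c cab] := @MVT_segment R (fun t => d t ord0 i) (fun t => dd t ord0 i) _ _ ab.
- move=> t; rewrite in_itv/= => /andP[/ltW at_ /ltW tb].
  have td := diP t (introT andP (conj at_ tb)).
  by apply: DeriveDef; [exact: diff_derivable|rewrite deriveE// (is_diffE _ td) mul1r].
- apply: derivable_within_continuous => t; rewrite in_itv/= => tab.
  by have td := diP t tab; exact: diff_derivable.
rewrite !mxE => ->; rewrite normrM (@ger0_norm _ (b - a)) ?subr_ge0//.
rewrite ler_wpM2r ?subr_ge0// (le_trans (rV_norm_coord _ _))// dB//.
Qed.

(** Both points are free, unlike in differentiability at [p]. The mean value estimate is applied on
    the segment from [v] to [u] to [f] minus its linear part at [p], whose derivative is small near
    [p]. *)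
Lemma strict_diff U n (b : frame U) (f : U -> 'rV[R]_n) (p : U) :
  (\forall q \near p, differentiable f q) ->
  (forall v, {for p, continuous (fun q => 'd f q v)}) ->
  forall e, 0 < e -> exists2 r, 0 < r &
    forall u v, `|u - p| < r -> `|v - p| < r ->
      `|f u - f v - 'd f p (u - v)| <= e * `|u - v|.
Proof.
move=> fd fc e e0.
have /nbhs_normP[r /= r0 rP] : \forall q \near p, differentiable f q /\
    forall v, `|'d f q v - 'd f p v| <= e * `|v|.
  by apply: filterI => //; exact: (linear_family_near b fc).
exists r => // u v up vp.
pose g t := f (v + t *: (u - v)) - t *: 'd f p (u - v).
have inball t : 0 <= t <= 1 -> `|p - (v + t *: (u - v))| < r.
  move=> /andP[t0 t1].
  have -> : p - (v + t *: (u - v)) = (1 - t) *: (p - v) + t *: (p - u).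
    have -> : u - v = (p - v) - (p - u) by rewrite opprB [RHS]addrC subrKA.
    by rewrite scalerBl scale1r scalerBr !opprD !opprK !addrA.
  rewrite (le_lt_trans (ler_normD _ _))// !normrZ !ger0_norm ?subr_ge0//.
  rewrite ![`|p - _|]distrC; move: up vp.
  by have [] := leP `|u - p| `|v - p| => ? ? ?; nra.
have := @mvt_norm n g (fun t => 'd f (v + t *: (u - v)) (u - v) - 'd f p (u - v))
  0 1 (e * `|u - v|) ler01.
rewrite subr0 mulr1 /g scale1r scale0r addr0 scale0r subr0 scale1r subrKC.
rewrite addrAC; apply => t /inball/rP[fdt fdB] //.
have ud : is_diff t (fun t : R => v + t *: (u - v)) (fun h : R => h *: (u - v)).
  have := is_diffD (is_diff_cst v t) (is_diff_scalel t (u - v)).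
  by move=> /is_diff_eq; apply; rewrite add0r.
have := is_diffB (is_diff_comp ud (differentiableP fdt)) (is_diff_scalel t ('d f p (u - v))).
move=> /is_diff_eq; apply; rewrite funeqE => h /=.
by rewrite [RHS]scalerBr -linearZ.
Qed.

End MeanValue.

(** * Locally Lipschitz maps *)

Section LocalLipschitz.
Context {R : realType}.
Implicit Types U V W Z : normedModType R.

(** A Lipschitz bound with both points free in a ball, since two solutions of an equation are to be
    compared. *)
Definition loclip U W (f : U -> W) (p : U) := exists2 K, 0 <= K &
  exists2 r, 0 < r & forall u v, `|u - p| < r -> `|v - p| < r ->
    `|f u - f v| <= K * `|u - v|.

Lemma C1_loclip U n (b : frame U) (f : U -> 'rV[R]_n) (p : U) :
  (\forall q \near p, differentiable f q) ->
  (forall v, {for p, continuous (fun q => 'd f q v)}) -> loclip f p.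
Proof.
move=> fd fc; have [k k0 kP] := linear_lipschitz (diff_continuous (nbhs_singleton fd)).
have [r r0 rP] := strict_diff b fd fc ltr01.
exists (k + 1); first by rewrite addr_ge0// ltW.
exists r => // u v up vp; rewrite mulrDl -[X in `|X|](subrK ('d f p (u - v))).
by rewrite (le_trans (ler_normD _ _))// addrC lerD// rP.
Qed.

Lemma loclip_cst U W (w : W) (p : U) : loclip (fun=> w) p.
Proof.
exists 0 => //; exists 1 => // u v _ _.
by rewrite subrr normr0 mul0r.
Qed.

Lemma loclip_linear U W (f : {linear U -> W}) (p : U) : continuous f -> loclip f p.
Proof.
move=> /linear_lipschitz[k k0 kP]; exists k; first exact: ltW.
by exists 1 => // u v _ _; rewrite -linearB.
Qed.

Lemma loclipD U W (f g : U -> W) (p : U) :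
  loclip f p -> loclip g p -> loclip (fun u => f u + g u) p.
Proof.
move=> [K K0 [r r0 fK]] [L L0 [s s0 gL]].
exists (K + L); first exact: addr_ge0.
exists (Num.min r s); first by rewrite lt_min r0.
move=> u v; rewrite !lt_min => /andP[ur us] /andP[vr vs].
rewrite opprD addrACA mulrDl (le_trans (ler_normD _ _))// lerD//.
  exact: fK.
exact: gL.
Qed.

Lemma loclip_sum U W (I : finType) (f : I -> U -> W) (p : U) :
  (forall i, loclip (f i) p) -> loclip (fun u => \sum_i f i u) p.
Proof.
move=> fL; rewrite -fct_sumE; elim/big_rec : _ => [|i g _ gL].
  exact: loclip_cst.
exact: loclipD.
Qed.

Lemma loclip_scale U W (k : U -> R) (f : U -> W) (p : U) :
  loclip k p -> loclip f p -> loclip (fun u => k u *: f u) p.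
Proof.
move=> [K K0 [r r0 kK]] [L L0 [s s0 fL]].
(* Bounds for the norms of [k] and [f] on the balls of radius [r] and [s]. *)
pose Bk := `|k p| + K * r; pose Bf := `|f p| + L * s.
exists (K * Bf + Bk * L).
  by rewrite addr_ge0// mulr_ge0// addr_ge0// mulr_ge0// ltW.
exists (Num.min r s); first by rewrite lt_min r0.
move=> u v; rewrite !lt_min => /andP[ur us] /andP[vr vs].
have kvB : `|k v| <= Bk.
  rewrite -[k v](subrKC (k p)) (le_trans (ler_normD _ _))// lerD2l.
  rewrite (le_trans (kK _ _ vr _)) ?subrr ?normr0//.
  by rewrite ler_wpM2l// ltW.
have fuB : `|f u| <= Bf.
  rewrite -[f u](subrKC (f p)) (le_trans (ler_normD _ _))// lerD2l.
  rewrite (le_trans (fL _ _ us _)) ?subrr ?normr0//.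
  by rewrite ler_wpM2l// ltW.
have -> : k u *: f u - k v *: f v = (k u - k v) *: f u + k v *: (f u - f v).
  by rewrite scalerBl scalerBr addrA subrK.
rewrite (le_trans (ler_normD _ _))// !normrZ mulrDl lerD//.
  by rewrite mulrAC ler_pM// kK.
by rewrite -mulrA ler_pM// fL.
Qed.

Lemma loclip_comp U V W (g : U -> V) (f : V -> W) (p : U) :
  loclip g p -> loclip f (g p) -> loclip (fun u => f (g u)) p.
Proof.
move=> [K K0 [r r0 gK]] [L L0 [s s0 fL]].
(* [K] may vanish, so the radius is divided by [K + 1] instead. *)
have K10 : 0 < K + 1 by rewrite ltr_pwDr.
exists (L * K); first exact: mulr_ge0.
exists (Num.min r (s / (K + 1))); first by rewrite lt_min r0 divr_gt0.
have small u : `|u - p| < Num.min r (s / (K + 1)) -> `|g u - g p| < s.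
  rewrite lt_min => /andP[ur]; rewrite ltr_pdivlMr// => us.
  rewrite (le_lt_trans (gK _ _ ur _)) ?subrr ?normr0//.
  by rewrite (le_lt_trans _ us)// mulrC ler_wpM2l// lerDl.
move=> u v up vp; rewrite (le_trans (fL _ _ (small _ up) (small _ vp)))//.
rewrite -mulrA ler_wpM2l// gK//.
  by move: up; rewrite lt_min => /andP[].
by move: vp; rewrite lt_min => /andP[].
Qed.

Lemma near_eq_loclip U W (f g : U -> W) (p : U) :
  (\forall q \near p, f q = g q) -> loclip f p -> loclip g p.
Proof.
move=> /nbhs_normP[s /= s0 fg] [K K0 [r r0 fK]].
exists K => //; exists (Num.min r s); first by rewrite lt_min r0.
move=> u v; rewrite !lt_min => /andP[ur us] /andP[vr vs].
by rewrite -!fg ?fK//= distrC.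
Qed.

Lemma loclip_continuous U W (f : U -> W) (p : U) :
  loclip f p -> {for p, continuous f}.
Proof.
move=> [K K0 [r r0 fK]]; apply/cvgrPdist_le => e e0.
have K10 : 0 < K + 1 by rewrite ltr_pwDr.
apply/nbhs_normP; exists (Num.min r (e / (K + 1))) => [|u] /=.
  by rewrite lt_min r0 divr_gt0.
rewrite lt_min ltr_pdivlMr// => /andP[ur ue].
rewrite (le_trans (fK _ _ _ _)) ?subrr ?normr0//; first by rewrite distrC.
by rewrite (le_trans _ (ltW ue))// mulrC ler_wpM2l// lerDl.
Qed.

Lemma loclip_pair U V W (f : U -> V) (g : U -> W) (p : U) :
  loclip f p -> loclip g p -> loclip (fun u => (f u, g u)) p.
Proof.
move=> [K K0 [r r0 fK]] [L L0 [s s0 gL]].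
exists (K + L); first exact: addr_ge0.
exists (Num.min r s); first by rewrite lt_min r0.
move=> u v; rewrite !lt_min => /andP[ur us] /andP[vr vs].
rewrite prod_normE /= mulrDl ge_max.
have := fK _ _ ur vr; have := gL _ _ us vs.
have : 0 <= K * `|u - v| by rewrite mulr_ge0.
have : 0 <= L * `|u - v| by rewrite mulr_ge0.
by move=> *; apply/andP; split; lra.
Qed.

Lemma loclip_id U (p : U) : loclip id p.
Proof. by exists 1 => //; exists 1 => // u v _ _; rewrite mul1r. Qed.

Lemma loclip_fst U V (p : U * V) : loclip fst p.
Proof.
exists 1 => //; exists 1 => // u v _ _.
by rewrite mul1r [leRHS]prod_normE le_max lexx.
Qed.

Lemma loclip_snd U V (p : U * V) : loclip snd p.
Proof.
exists 1 => //; exists 1 => // u v _ _.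
by rewrite mul1r [leRHS]prod_normE le_max lexx orbT.
Qed.

Lemma loclip_linear_family U W Z (b : frame U) (L : Z -> {linear U -> W})
    (w : Z -> U) (a : Z) :
  (forall v, loclip (fun z => L z v) a) -> loclip w a ->
  loclip (fun z => L z (w z)) a.
Proof.
move=> LL wl.
have -> : (fun z => L z (w z)) =
    fun z => \sum_(i : fr_index b) fr_coord i (w z) *: L z (fr_vec i).
  by rewrite funeqE => z; exact: linear_frame.
apply: loclip_sum => i; apply: loclip_scale => //.
exact/(loclip_comp wl)/loclip_linear/fr_coord_continuous.
Qed.

End LocalLipschitz.

(** * Implicit functions *)

Section ImplicitFunction.
Context {R : realType}.

(** Gives matrices the complete normed module structure that the Banach fixed point theorem asks
    for. *)
HB.instance Definition _ m n := Complete.on 'M[R]_(m, n).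

(* The chord (simplified Newton) iteration z |-> z - M (F (y, z) - t) is a
   contraction near (y0, z0). *)
Lemma local_solve (U : normedModType R) (b : frame U) n
    (F : U * 'rV[R]_n -> 'rV[R]_n) (y0 : U) (z0 : 'rV[R]_n)
    (M : {linear 'rV[R]_n -> 'rV[R]_n}) :
  (\forall q \near (y0, z0), differentiable F q) ->
  (forall v, {for (y0, z0), continuous (fun q => 'd F q v)}) ->
  continuous M ->
  (forall v, M ('d F (y0, z0) (0, v)) = v) ->
  (forall v, 'd F (y0, z0) (0, M v) = v) ->
  forall e, 0 < e -> exists2 r, 0 < r & forall y t, `|y - y0| < r ->
    `|t - F (y0, z0)| < r -> exists2 z, `|z - z0| <= e & F (y, z) = t.
Proof.
move=> Fd Fc Mc MS SM e e0.
have [m m0 mP] := linear_lipschitz Mc.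
(* [M] has norm at most [m], so this precision makes the iteration contract by 1/2. *)
have eps0 : 0 < (2 * m)^-1 by rewrite invr_gt0 mulr_gt0.
have [rho rho0 rhoP] := strict_diff (prod_frame b (rV_frame n)) Fd Fc eps0.
pose e' := Num.min e (rho / 2).
have e'0 : 0 < e' by rewrite lt_min e0 divr_gt0.
have e'rho : e' < rho.
  by rewrite (le_lt_trans (_ : _ <= rho / 2)) ?ge_min ?lexx ?orbT//; lra.
(* [t] and [F (y, z0)] both stay this close to [F (y0, z0)], so the first iterate moves [z0] by at
   most e'/2; the contraction accounts for the other half, and the ball of radius e' is
   preserved. *)
have d0 : 0 < e' / (4 * m) by rewrite divr_gt0 // mulr_gt0.
have /nbhs_normP[r' /= r'0 r'P] : \forall q \near (y0, z0),
    `|F q - F (y0, z0)| < e' / (4 * m).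
  have /cvgrPdist_lt/(_ _ d0) := differentiable_continuous (nbhs_singleton Fd).
  by apply: filterS => q; rewrite distrC.
exists (Num.min rho (Num.min r' (e' / (4 * m)))); first by rewrite !lt_min rho0 r'0.
move=> y t; rewrite !lt_min => /andP[yrho /andP[yr' _]] /andP[_ /andP[_ td]].
pose G z := z - M (F (y, z) - t).
pose B := closed_ball_ (@Num.Def.normr R 'rV[R]_n) z0 e'.
have Brho z : B z -> `|(y, z) - (y0, z0)| < rho.
  rewrite /B /closed_ball_ /= => zB.
  by rewrite prod_normE /= num_gt_max /= yrho /= distrC (le_lt_trans zB).
have Gcontr z z' : B z -> B z' -> `|G z - G z'| <= 2^-1 * `|z - z'|.
  move=> /Brho zB /Brho z'B; have := rhoP _ _ zB z'B.
  have -> : (y, z) - (y, z') = (0, z - z').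
    by congr (_, _); rewrite /= subrr.
  have -> : G z - G z' = - M (F (y, z) - F (y, z') - 'd F (y0, z0) (0, z - z')).
    have -> : F (y, z) - F (y, z') = (F (y, z) - t) - (F (y, z') - t).
      by rewrite opprB addrA subrK.
    rewrite [M (_ - 'd F _ _)]linearB MS [M (_ - _)]linearB /G !opprB.
    by rewrite [M _ - z']addrC addrACA [- M _ + _]addrC.
  rewrite normrN prod_normE /= normr0 (max_idPr _)// => zz'.
  rewrite (le_trans (mP _))// (le_trans (ler_wpM2l (ltW m0) zz'))// mulrA.
  by rewrite (_ : m * (2 * m)^-1 = 2^-1)//; field; rewrite gt_eqF.
have Gz0 : `|G z0 - z0| <= e' / 2.
  rewrite /G addrAC subrr add0r normrN (le_trans (mP _))//.
  have : `|F (y, z0) - t| <= e' / (4 * m) + e' / (4 * m).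
    rewrite -[F (y, z0)](subrK (F (y0, z0))) -addrA (le_trans (ler_normD _ _))//.
    rewrite lerD//; last by rewrite distrC ltW.
    apply/ltW/r'P; rewrite /= prod_normE /= subrr normr0 distrC.
    by rewrite (max_idPl _).
  move=> /(ler_wpM2l (ltW m0)) /le_trans; apply.
  by rewrite le_eqVlt; apply/orP; left; apply/eqP; field; rewrite gt_eqF.
have GB : {homo G : z / B z >-> B z}.
  move=> z zB; rewrite /B /closed_ball_ /= distrC.
  rewrite -[G z](subrK (G z0)) -addrA (le_trans (ler_normD _ _))//.
  have z0B : B z0 by rewrite /B /closed_ball_ /= subrr normr0 ltW.
  have := Gcontr _ _ zB z0B; move: zB; rewrite /B /closed_ball_/= distrC; lra.
have Gc : is_contraction (mkfun_fun GB).
  exists (2^-1)%:nng; split => /=; first by rewrite invf_lt1 ?ltr1n.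
  by move=> -[z z'] [/= zB z'B]; exact: Gcontr.
have [] := @banach_fixed_point R 'rV[R]_n B (mkfun_fun GB) Gc.
- exact: closed_closed_ball_.
- by exists z0; rewrite /B /closed_ball_ /= subrr normr0 ltW.
move=> z zB zG; exists z.
  by move: zB; rewrite /B /closed_ball_ /= distrC /e' le_min => /andP[].
have M0 : M (F (y, z) - t) = 0.
  apply/eqP; rewrite -oppr_eq0 -[X in _ == X](subrr z) [X in _ == X - _]zG.
  by rewrite /mkfun_fun /= /mkfun /G addrAC subrr add0r.
(* A fixed point only says that [M] kills the defect; the right inverse identity [SM] makes the
   defect itself zero. *)
by apply/eqP; rewrite -subr_eq0 -[X in X == _]SM M0 [X in 'd F _ X](_ : _ = 0) ?linear0.
Qed.

(** The solution [g] is given and continuous at the point. The expansion of [F] along the graph of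
    [g] first yields a linear growth bound for [g], and this bound turns the error term into one
    that is small relative to the increment. *)
Lemma implicit_differentiable (U W V : normedModType R) (F : U * V -> W)
    (g : U * W -> V) (y0 : U) (z0 : V) (M : {linear W -> V}) :
  differentiable F (y0, z0) ->
  continuous M -> (forall v, M ('d F (y0, z0) (0, v)) = v) ->
  g (y0, F (y0, z0)) = z0 -> {for (y0, F (y0, z0)), continuous g} ->
  (\forall q \near (y0, F (y0, z0)), F (q.1, g q) = q.2) ->
  differentiable g (y0, F (y0, z0)).
Proof.
move=> Fd Mc MS gz0 gc gF; set q0 := (y0, F (y0, z0)).
(* Found by formally differentiating F(y, g(y, t)) = t and solving for the derivative of g. *)
pose D (h : U * W) := M (h.2 - 'd F (y0, z0) (h.1, 0)).
have Dlin : linear D.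
  move=> k u v; rewrite /D -linearP scalerBr; congr (M _).
  have -> : ((k *: u + v).1, 0 : V) = k *: (u.1, 0) + (v.1, 0).
    by congr (_, _); rewrite /= scaler0 addr0.
  by rewrite ['d F _ _]linearP opprD addrACA.
pose DM := GRing.isLinear.Build _ _ _ _ D Dlin.
pose DL : {linear (U * W)%type -> V} := HB.pack D DM.
have Dc : continuous DL.
  have E : continuous (fun h : U * W => h.2 - 'd F (y0, z0) (h.1, 0)).
    move=> q; apply: continuousB; first exact: cvg_snd.
    apply: (@continuous_comp _ _ _ (fun q : U * W => (q.1, 0 : V)) ('d F (y0, z0))).
      by apply: cvg_pair; [exact: cvg_fst|exact: cvg_cst].
    exact: diff_continuous.
  by move=> q; apply: continuous_comp (E q) (Mc _).
suff : is_diff q0 g DL by case.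
have [m m0 mP] := linear_lipschitz Mc.
have [L L0 LP] := linear_lipschitz (diff_continuous Fd).
(* If m eps <= 1/2, then |G| <= (|h| + |G|)/2 + m (1 + L) |h|; absorbing |G|/2 on the left gives |G|
   <= C |h|. *)
pose C := 2 * m * (1 + L) + 1.
have C0 : 0 < C by rewrite /C; nra.
apply: is_diff_epsP => // e e0.
(* The first entry allows the absorption, the second brings the final error m eps (1 + C) |h| below
   e |h|. *)
pose eps := Num.min (2 * m)^-1 (e / (m * (1 + C))).
have eps0 : 0 < eps.
  by rewrite lt_min invr_gt0 mulr_gt0//= divr_gt0// mulr_gt0// addr_gt0.
have Fg : \forall q \near q0, `|F (q.1, g q) - F (y0, z0)
     - 'd F (y0, z0) ((q.1, g q) - (y0, z0))| <= eps * `|(q.1, g q) - (y0, z0)|.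
  have gpc : (q.1, g q) @[q --> q0] --> (y0, z0).
    have gc' : g q @[q --> q0] --> z0 by rewrite -[X in _ --> X]gz0.
    by apply: cvg_pair; [exact: cvg_fst|exact: gc'].
  exact: gpc (differentiable_eps Fd eps0).
near=> q; rewrite gz0 /= /D.
have Fgq : F (q.1, g q) = q.2 by near: q.
have : `|F (q.1, g q) - F (y0, z0) - 'd F (y0, z0) ((q.1, g q) - (y0, z0))|
    <= eps * `|(q.1, g q) - (y0, z0)| by near: q.
rewrite Fgq.
have -> : (q.1, g q) - (y0, z0) = (q.1 - y0, 0) + (0, g q - z0).
  by congr (_, _); rewrite /= ?addr0 ?add0r.
rewrite linearD.
set h := q - q0; have -> : q.2 - F (y0, z0) = h.2 by [].
have -> : q.1 - y0 = h.1 by [].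
set G := g q - z0 => hG.
have h1 : `|h.1| <= `|h| by rewrite [leRHS]prod_normE /= le_max lexx.
have h2 : `|h.2| <= `|h| by rewrite [leRHS]prod_normE /= le_max lexx orbT.
have hGn : `|(h.1, 0 : V) + (0, G)| <= `|h| + `|G|.
  rewrite (le_trans (ler_normD _ _))// !prod_normE /= !normr0.
  by rewrite (max_idPl _)// (max_idPr _)// lerD2r.
have GE : G - M (h.2 - 'd F (y0, z0) (h.1, 0)) =
    - M (h.2 - ('d F (y0, z0) (h.1, 0) + 'd F (y0, z0) (0, G))).
  by rewrite opprD addrA [M (_ - 'd F _ (0, G))]linearB MS opprB.
have Gm : `|G - M (h.2 - 'd F (y0, z0) (h.1, 0))| <= m * (eps * (`|h| + `|G|)).
  rewrite GE normrN (le_trans (mP _))// ler_wpM2l ?(ltW m0)// (le_trans hG)//.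
  by rewrite ler_wpM2l// ltW.
have Mh : `|M (h.2 - 'd F (y0, z0) (h.1, 0))| <= m * ((1 + L) * `|h|).
  rewrite (le_trans (mP _))// ler_wpM2l ?(ltW m0)// (le_trans (ler_normB _ _))//.
  rewrite mulrDl mul1r lerD// (le_trans (LP _))// prod_normE/= normr0.
  by rewrite (max_idPl _)// ler_wpM2l// ltW.
have meps : m * eps <= 2^-1.
  rewrite -ler_pdivlMl// -invfM mulrC /eps ge_min mulrC lexx//.
have GC : `|G| <= C * `|h|.
  have : `|G| <= m * (eps * (`|h| + `|G|)) + m * ((1 + L) * `|h|).
    rewrite -[G in leLHS](subrK (M (h.2 - 'd F (y0, z0) (h.1, 0)))).
    by rewrite (le_trans (ler_normD _ _))// lerD.
  have : m * eps * (`|h| + `|G|) <= 2^-1 * (`|h| + `|G|) by rewrite ler_wpM2r.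
  rewrite /C; have := normr_ge0 h; nra.
rewrite (le_trans Gm)//.
have : `|h| + `|G| <= (1 + C) * `|h| by lra.
have : eps <= e / (m * (1 + C)) by rewrite /eps ge_min lexx orbT.
rewrite ler_pdivlMr; last by rewrite mulr_gt0// addr_gt0.
move=> He HG; rewrite (le_trans (_ : _ <= m * (eps * ((1 + C) * `|h|))))//.
  by rewrite ler_wpM2l ?(ltW m0)// ler_wpM2l// ltW.
rewrite (_ : _ * _ = eps * (m * (1 + C)) * `|h|); last by ring.
by rewrite ler_wpM2r.
Unshelve. all: by end_near. Qed.

End ImplicitFunction.

(** * Uniqueness for ordinary differential equations *)

Section RealCurves.
Context {R : realType}.

(* Gronwall by the mean value inequality on an interval so short that the
   maximum of the two norms is at most half of itself. *)
Lemma ode_pair_zero n (d1 d2 dd1 dd2 : R -> 'rV[R]_n) (u0 L : R) :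
  d1 u0 = 0 -> d2 u0 = 0 ->
  (\forall u \near u0, [/\ is_diff u d1 (fun h => h *: dd1 u),
     is_diff u d2 (fun h => h *: dd2 u),
     `|dd1 u| <= L * (`|d1 u| + `|d2 u|) &
     `|dd2 u| <= L * (`|d1 u| + `|d2 u|)]) ->
  \forall u \near u0, d1 u = 0 /\ d2 u = 0.
Proof.
move=> d10 d20 /nbhs_normP[r /= r0 rP].
pose L' := `|L| + 1; have L'0 : 0 < L' by rewrite ltr_wpDl.
have LL' : L <= L' by rewrite (le_trans (ler_norm _))// lerDl.
(* r/2 keeps the closed interval inside the neighbourhood; the other entry gives L' de <= 1/4, so
   each of the two norms is at most a quarter of the maximum of their sum. *)
pose de := Num.min (r / 2) (4 * L')^-1.
have de0 : 0 < de by rewrite lt_min divr_gt0//= invr_gt0 mulr_gt0.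
have deL : L' * de <= 4^-1.
  by rewrite -ler_pdivlMl// -invfM mulrC /de ge_min mulrC lexx orbT.
have der : de < r.
  by rewrite (le_lt_trans (_ : _ <= r / 2)) ?ge_min ?lexx//; lra.
pose N u := `|d1 u| + `|d2 u|.
have inI u : u0 - de <= u <= u0 + de -> `|u0 - u| < r.
  by move=> /andP[? ?]; rewrite (le_lt_trans _ der)// ler_norml; lra.
have N0 u : 0 <= N u by rewrite addr_ge0.
have Nc : {within `[u0 - de, u0 + de], continuous N}.
  apply: continuous_in_subspaceT => u; rewrite inE /= in_itv/= => /inI/rP[d1d d2d _ _].
  have h1 : `|d1 v| @[v --> u] --> `|d1 u|.
    by apply: cvg_norm; exact: differentiable_continuous.
  have h2 : `|d2 v| @[v --> u] --> `|d2 u|.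
    by apply: cvg_norm; exact: differentiable_continuous.
  exact: cvgD h1 h2.
have [|m mI mP] := EVT_max _ Nc; first lra.
have bound (d dd : R -> 'rV[R]_n) : d u0 = 0 ->
    (forall u, u0 - de <= u <= u0 + de -> is_diff u d (fun h => h *: dd u)) ->
    (forall u, u0 - de <= u <= u0 + de -> `|dd u| <= L * N u) ->
  forall u, u0 - de <= u <= u0 + de -> `|d u| <= 4^-1 * N m.
  move=> du0 dd_diff ddB u uI.
  have ddB' v : u0 - de <= v <= u0 + de -> `|dd v| <= L' * N m.
    move=> vI; rewrite (le_trans (ddB _ vI))//.
    rewrite (le_trans (_ : _ <= L' * N v))//; first by rewrite ler_wpM2r.
    by rewrite ler_wpM2l ?(ltW L'0)// mP// in_itv.
  have L'N : L' * N m * de <= 4^-1 * N m by rewrite mulrAC ler_wpM2r.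
  have L'N0 : 0 <= L' * N m by rewrite mulr_ge0// ltW.
  case/andP: (uI) => u1 u2; have [u0u|/ltW uu0] := leP u0 u.
    have := @mvt_norm _ n d dd u0 u (L' * N m) u0u; rewrite du0 subr0 => dB.
    rewrite (le_trans (dB _ _))//.
    - by move=> t /andP[? ?]; apply: dd_diff; lra.
    - by move=> t /andP[? ?]; apply: ddB'; lra.
    by rewrite (le_trans _ L'N)// ler_wpM2l//; lra.
  have := @mvt_norm _ n d dd u u0 (L' * N m) uu0; rewrite du0 sub0r normrN => dB.
  rewrite (le_trans (dB _ _))//.
  - by move=> t /andP[? ?]; apply: dd_diff; lra.
  - by move=> t /andP[? ?]; apply: ddB'; lra.
  by rewrite (le_trans _ L'N)// ler_wpM2l//; lra.
have d1B u : u0 - de <= u <= u0 + de -> `|d1 u| <= 4^-1 * N m.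
  by apply: (bound d1 dd1) => // v /inI/rP[].
have d2B u : u0 - de <= u <= u0 + de -> `|d2 u| <= 4^-1 * N m.
  by apply: (bound d2 dd2) => // v /inI/rP[].
have Nm : N m = 0.
  have mI' : u0 - de <= m <= u0 + de by move: mI; rewrite in_itv.
  have := d1B _ mI'; have := d2B _ mI'; have := N0 m; rewrite /N; lra.
apply/nbhs_normP; exists de => //= u /ltW; rewrite ler_norml => uI.
have uI' : u0 - de <= u <= u0 + de by lra.
by split; apply/eqP; rewrite -normr_le0 -(mulr0 4^-1) -Nm; [exact: d1B|exact: d2B].
Qed.

(** Connectedness of [J]: the set where [P] holds is nonempty and both relatively open and
    relatively closed. It extends local coincidence of curves to the whole interval. *)
Lemma open_interval_ind (J : set R) (P : R -> Prop) (u0 : R) :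
  open J -> is_interval J -> J u0 -> P u0 ->
  (forall u, J u -> P u -> \forall v \near u, P v) ->
  (forall u, J u -> ~ P u -> \forall v \near u, ~ P v) ->
  forall u, J u -> P u.
Proof.
move=> oJ iJ Ju0 Pu0 Popen Nopen.
have Jnear u : J u -> \forall v \near u, J v by move=> Ju; exact: open_nbhs_nbhs (conj oJ Ju).
have : J `&` [set u | P u] = J.
  have /connected_intervalP := iJ; apply.
  - by exists u0.
  - exists (J `&` [set u | P u]); last by rewrite setIA setIid.
    rewrite openE => u [Ju Pu]; rewrite /interior.
    by apply: filterI; [exact: Jnear|exact: Popen].
  - exists (~` (J `&` [set u | ~ P u])).
      apply: open_closedC; rewrite openE => u [Ju Pu]; rewrite /interior.
      by apply: filterI; [exact: Jnear|exact: Nopen].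
    apply/seteqP; split => u [Ju Pu]; split => //.
      by move=> [_ ].
    by apply: contrapT => NPu; apply: Pu.
by move=> E u; rewrite -{1}E => -[].
Qed.

End RealCurves.

(** * First-order consequences of smoothness on a set *)

Section SmoothOn.
Context {R : realType}.

Lemma smooth_on_differentiable (U W : normedModType R) (A : set U) (f : U -> W) (p : U) :
  smooth_on A f -> A p -> differentiable f p.
Proof. by move=> fs Ap; have [fd _] := fs 1; exact: fd. Qed.

Lemma smooth_on_diff (U W : normedModType R) (A : set U) (f : U -> W) (v : U) :
  smooth_on A f -> smooth_on A (fun q => 'd f q v).
Proof. by move=> fs k; have [_ dfs] := fs k.+1; exact: dfs. Qed.

Lemma smooth_on_C1 (U W : normedModType R) (A : set U) (f : U -> W) (p : U) :
  open A -> smooth_on A f -> A p ->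
  (\forall q \near p, differentiable f q) /\
  (forall v, {for p, continuous (fun q => 'd f q v)}).
Proof.
move=> oA fs Ap; split.
  have : \forall q \near p, A q by exact: open_nbhs_nbhs (conj oA Ap).
  by apply: filterS => q; exact: smooth_on_differentiable.
move=> v; apply/differentiable_continuous/smooth_on_differentiable/Ap.
exact: smooth_on_diff.
Qed.

End SmoothOn.

(** * Calculus of a deformation *)

Section DeformationCalculus.
Context {R : realType} {n : nat} (H : deformation R n).
Local Notation V := 'rV[R]_n.
Implicit Types (x y z t v w a b tau : V) (u r s : R).

Definition Hpair (p : V * V) : V := H p.1 p.2.
Local Notation F := Hpair.

Lemma dfm_dom_basel y z : dfm_dom H (y, z) -> dfm_base H y.
Proof. by move=> /dfm_dom_base[]. Qed.

Lemma dfm_domE y z : xsection (dfm_dom H) y z = dfm_dom H (y, z).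
Proof. by rewrite /xsection /= inE. Qed.

Lemma near_dfm_base y : dfm_base H y -> \forall q \near y, dfm_base H q.
Proof. by move=> Xy; exact: open_nbhs_nbhs (conj (@dfm_base_open _ _ H) Xy). Qed.

Lemma near_dfm_dom p : dfm_dom H p -> \forall q \near p, dfm_dom H q.
Proof. by move=> Dp; exact: open_nbhs_nbhs (conj (@dfm_dom_open _ _ H) Dp). Qed.

Lemma near_section y z : dfm_dom H (y, z) -> \forall w \near z, dfm_dom H (y, w).
Proof.
move=> Dyz; have [[oD _] _ _ _] := dfm_diffeo (dfm_dom_basel Dyz).
have : \forall w \near z, xsection (dfm_dom H) y w.
  by apply: open_nbhs_nbhs; split; rewrite ?dfm_domE.
by apply: filterS => w; rewrite dfm_domE.
Qed.

Lemma near_Kdom y t : Kdom H y t -> \forall w \near t, Kdom H y w.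
Proof.
move=> [z]; rewrite dfm_domE => Dyz zt.
have [[_ oK] _ _ _] := dfm_diffeo (dfm_dom_basel Dyz).
by apply: open_nbhs_nbhs; split => //; exists z; rewrite ?dfm_domE.
Qed.

Lemma Kmap_dom y t : Kdom H y t -> dfm_dom H (y, Kmap H y t).
Proof.
move=> [z]; rewrite dfm_domE => Dyz <-.
have [_ inj _ _] := dfm_diffeo (dfm_dom_basel Dyz).
by rewrite /Kmap pinvKV ?inE ?dfm_domE.
Qed.

Lemma HK y t : Kdom H y t -> H y (Kmap H y t) = t.
Proof. by move=> Kyt; rewrite /Kmap pinvK ?inE. Qed.

Lemma KH y z : dfm_dom H (y, z) -> Kmap H y (H y z) = z.
Proof.
move=> Dyz; have [_ inj _ _] := dfm_diffeo (dfm_dom_basel Dyz).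
by rewrite /Kmap pinvKV ?inE ?dfm_domE.
Qed.

Lemma Kdom_H y z : dfm_dom H (y, z) -> Kdom H y (H y z).
Proof. by move=> Dyz; exists z; rewrite ?dfm_domE. Qed.

Lemma Kdom_base y t : Kdom H y t -> dfm_base H y.
Proof. by move=> /Kmap_dom/dfm_dom_basel. Qed.

Lemma Kdom0 y : dfm_base H y -> Kdom H y 0.
Proof. by move=> Xy; rewrite -(dfm_map0 Xy); exact/Kdom_H/dfm_dom0. Qed.

Lemma Kmap0 y : dfm_base H y -> Kmap H y 0 = 0.
Proof. by move=> Xy; rewrite -{1}(dfm_map0 Xy) KH//; exact: dfm_dom0. Qed.

Lemma H_smooth y : dfm_base H y -> smooth_on (xsection (dfm_dom H) y) (H y).
Proof. by move=> /dfm_diffeo[]. Qed.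

Lemma Kmap_smooth y : dfm_base H y -> smooth_on (Kdom H y) (Kmap H y).
Proof. by move=> /dfm_diffeo[]. Qed.

Lemma H_differentiable y z : dfm_dom H (y, z) -> differentiable (H y) z.
Proof.
move=> Dyz; apply: smooth_on_differentiable (H_smooth (dfm_dom_basel Dyz)) _.
by rewrite dfm_domE.
Qed.

Lemma dH_differentiable y z v :
  dfm_dom H (y, z) -> differentiable (fun w => 'd (H y) w v) z.
Proof.
move=> Dyz; apply: (@smooth_on_differentiable _ _ _ (xsection (dfm_dom H) y)).
  by apply: smooth_on_diff; exact: H_smooth (dfm_dom_basel Dyz).
by rewrite dfm_domE.
Qed.

Lemma Kmap_differentiable y t : Kdom H y t -> differentiable (Kmap H y) t.
Proof. by move=> Kt; exact: smooth_on_differentiable (Kmap_smooth (Kdom_base Kt)) Kt. Qed.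

Lemma dKmap_smooth y v :
  dfm_base H y -> smooth_on (Kdom H y) (fun t => 'd (Kmap H y) t v).
Proof. by move=> Xy; exact/smooth_on_diff/Kmap_smooth. Qed.

Lemma dK_dH y z v : dfm_dom H (y, z) -> 'd (Kmap H y) (H y z) ('d (H y) z v) = v.
Proof.
move=> Dyz.
have Kd : is_diff z (Kmap H y \o H y) ('d (Kmap H y) (H y z) \o 'd (H y) z).
  apply: is_diff_comp; apply: differentiableP; first exact: H_differentiable.
  exact/Kmap_differentiable/Kdom_H.
have : is_diff z id ('d (Kmap H y) (H y z) \o 'd (H y) z).
  apply: near_eq_is_diff Kd.
  by have := near_section Dyz; apply: filterS => w; exact: KH.
by move=> idd; exact: is_diff_unique idd (is_diff_id _).
Qed.

Lemma dH_dK y t v : Kdom H y t -> 'd (H y) (Kmap H y t) ('d (Kmap H y) t v) = v.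
Proof.
move=> Kt.
have Hd : is_diff t (H y \o Kmap H y) ('d (H y) (Kmap H y t) \o 'd (Kmap H y) t).
  apply: is_diff_comp; apply: differentiableP; first exact: Kmap_differentiable.
  exact/H_differentiable/Kmap_dom.
have : is_diff t id ('d (H y) (Kmap H y t) \o 'd (Kmap H y) t).
  apply: near_eq_is_diff Hd.
  by have := near_Kdom Kt; apply: filterS => w; exact: HK.
by move=> idd; exact: is_diff_unique idd (is_diff_id _).
Qed.

Lemma dK_hmap y v : dfm_base H y -> 'd (Kmap H y) 0 (hmap H y v) = v.
Proof.
by move=> Xy; have := dK_dH v (dfm_dom0 Xy); rewrite dfm_map0.
Qed.

Lemma hmap_dK y v : dfm_base H y -> hmap H y ('d (Kmap H y) 0 v) = v.
Proof.
by move=> Xy; have := dH_dK v (Kdom0 Xy); rewrite Kmap0.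
Qed.

(** [kmap] is a partial inverse, so surjectivity of [hmap] must be shown: the derivative of [Kmap]
    at 0 supplies preimages. *)
Lemma hmap_kmap y v : dfm_base H y -> hmap H y (kmap H y v) = v.
Proof.
move=> Xy; apply: pinvK; rewrite inE.
by exists ('d (Kmap H y) 0 v) => //; exact: hmap_dK.
Qed.

Lemma Hpair_smooth : smooth_on (dfm_dom H) F.
Proof. exact: dfm_smooth. Qed.

Lemma Hpair_differentiable p : dfm_dom H p -> differentiable F p.
Proof. exact/smooth_on_differentiable/Hpair_smooth. Qed.

(** Rewrites a fibre derivative through the joint map, where its dependence on the base point is
    smooth. *)
Lemma dHE y z v : dfm_dom H (y, z) -> 'd (H y) z v = 'd F (y, z) (0, v).
Proof.
move=> Dyz; have := is_diff_comp (is_diff_pair (is_diff_cst y z) (is_diff_id z))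
  (differentiableP (Hpair_differentiable Dyz)).
exact: is_diffE.
Qed.

Lemma hmapE y v : dfm_base H y -> hmap H y v = 'd F (y, 0) (0, v).
Proof. by move=> Xy; apply: dHE; exact: dfm_dom0. Qed.

Lemma D2HE y a b : dfm_base H y ->
  D2H H y a b = 'd (fun q => 'd F q (0, b)) (y, 0) (0, a).
Proof.
move=> Xy; have D0 := dfm_dom0 Xy.
have dFd : differentiable (fun q => 'd F q (0, b)) (y, 0).
  exact: smooth_on_differentiable (smooth_on_diff _ Hpair_smooth) D0.
have c := is_diff_comp (is_diff_pair (is_diff_cst y 0) (is_diff_id 0))
  (differentiableP dFd).
have : is_diff 0 (fun w => 'd (H y) w b)
    (fun v => 'd (fun q => 'd F q (0, b)) (y, 0) (0, v)).
  apply: near_eq_is_diff c; have := near_section D0.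
  by apply: filterS => w Dyw; rewrite dHE.
exact: is_diffE.
Qed.

End DeformationCalculus.

(** * Rays and the canonical relation along them *)

Section Rays.
Context {R : realType} {n : nat} (H : deformation R n).
Local Notation V := 'rV[R]_n.
Implicit Types (x y z t v w a b tau sigma : V) (u r s : R).
Local Notation F := (Hpair H).

Definition ray x tau u : V := translate H x (u *: tau).
Definition ray_velocity x tau u : V := 'd (Kmap H x) (u *: tau) tau.
Definition ray_acceleration x tau u : V :=
  'd (fun t => 'd (Kmap H x) t tau) (u *: tau) tau.

Lemma near_ray_dom x tau u : Kdom H x (u *: tau) ->
  \forall r \near u, Kdom H x (r *: tau).
Proof. by move=> /near_Kdom; apply: (@scalel_continuous _ _ tau u). Qed.

Lemma is_diff_Kmap_ray x tau u : Kdom H x (u *: tau) ->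
  is_diff u (fun r => Kmap H x (r *: tau)) (fun h => h *: ray_velocity x tau u).
Proof.
move=> Ku; have := is_diff_comp (is_diff_scalel u tau)
  (differentiableP (Kmap_differentiable Ku)).
by move=> /is_diff_eq; apply; rewrite funeqE => h /=; rewrite linearZ.
Qed.

Lemma is_diff_ray x tau u : Kdom H x (u *: tau) ->
  is_diff u (ray x tau) (fun h => h *: ray_velocity x tau u).
Proof.
move=> Ku; have := is_diffD (is_diff_cst x u) (is_diff_Kmap_ray Ku).
by move=> /is_diff_eq; apply; rewrite add0r.
Qed.

Lemma is_diff_ray_velocity x tau u : Kdom H x (u *: tau) ->
  is_diff u (ray_velocity x tau) (fun h => h *: ray_acceleration x tau u).
Proof.
move=> Ku; have Kd := dKmap_smooth tau (Kdom_base Ku).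
have := is_diff_comp (is_diff_scalel u tau)
  (differentiableP (smooth_on_differentiable Kd Ku)).
by move=> /is_diff_eq; apply; rewrite funeqE => h /=; rewrite linearZ.
Qed.

Lemma ray_acceleration_continuous x tau u : Kdom H x (u *: tau) ->
  {for u, continuous (ray_acceleration x tau)}.
Proof.
move=> Ku.
have Kd := smooth_on_diff tau (dKmap_smooth tau (Kdom_base Ku)).
rewrite /prop_for /continuous_at /ray_acceleration.
have c1 : r *: tau @[r --> u] --> u *: tau by exact: scalel_continuous.
have c2 := differentiable_continuous (smooth_on_differentiable Kd Ku).
exact: (cvg_comp _ _ c1 c2).
Qed.

Lemma ray_continuous x tau u : Kdom H x (u *: tau) -> {for u, continuous (ray x tau)}.
Proof. by move=> /is_diff_ray rd; exact: differentiable_continuous. Qed.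

Lemma ray_velocity_continuous x tau u : Kdom H x (u *: tau) ->
  {for u, continuous (ray_velocity x tau)}.
Proof. by move=> /is_diff_ray_velocity rd; exact: differentiable_continuous. Qed.

Lemma ray0 x tau : dfm_base H x -> ray x tau 0 = x.
Proof. by move=> Xx; rewrite /ray /translate scale0r Kmap0// addr0. Qed.

Lemma ray_velocity0 x tau : ray_velocity x tau 0 = 'd (Kmap H x) 0 tau.
Proof. by rewrite /ray_velocity scale0r. Qed.

Lemma phi0l x t : dfm_base H x -> Kdom H x t -> phi H x 0 t = t.
Proof.
by move=> Xx Kt; rewrite /phi /translate Kmap0// addr0 add0r HK.
Qed.

Section CanonicalLine.
Variables (x tau sigma : V) (u : R).
Hypotheses (Ku : Kdom H x (u *: tau)) (Xu : dfm_base H (ray x tau u)).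
Hypothesis phi_line : forall s, phi_dom H x (u *: tau) (s *: sigma) ->
  phi H x (u *: tau) (s *: sigma) = (u + s) *: tau.
Local Notation y := (ray x tau u).

Lemma near_phi_dom_line : \forall s \near 0, phi_dom H x (u *: tau) (s *: sigma).
Proof.
have Ky0 : Kdom H y (0 *: sigma) by rewrite scale0r; exact: Kdom0.
have near1 := near_ray_dom Ky0.
have Kc : Kmap H x (u *: tau) + Kmap H y (s *: sigma) @[s --> 0] -->
    Kmap H x (u *: tau).
  rewrite -[X in _ --> X]addr0 -[X in _ --> _ + X](Kmap0 Xu) -(scale0r sigma).
  have Kc0 : {for 0, continuous (fun s => Kmap H y (s *: sigma))}.
    by have [? _] := is_diff_Kmap_ray Ky0; exact: differentiable_continuous.
  by apply: cvgD; [exact: cvg_cst|exact: Kc0].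
have near2 := Kc _ (near_section (Kmap_dom Ku)).
near=> s; split => //; first by near: s.
by rewrite dfm_domE; near: s.
Unshelve. all: by end_near. Qed.

(** K_x applied to the canonical relation: continuing the ray past y agrees with starting a new ray
    at y in the direction [sigma]. *)
Lemma near_Kmap_line : \forall s \near 0, Kdom H x ((u + s) *: tau) /\
  Kmap H x ((u + s) *: tau) = Kmap H x (u *: tau) + Kmap H y (s *: sigma).
Proof.
have := near_phi_dom_line; apply: filterS => s phis.
rewrite -(phi_line phis) /phi; case: phis => _ _; rewrite dfm_domE => Ds.
by split; [exact: Kdom_H|rewrite KH].
Qed.

(** The derivative of the previous identity at s = 0. It shows that the relation determines [sigma],
    so a canonical curve and the ray have the same value of h_y(y') at a common point y. *)
Lemma line_velocity : hmap H y (ray_velocity x tau u) = sigma.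
Proof.
have Ky0 : Kdom H y (0 *: sigma) by rewrite scale0r; exact: Kdom0.
have Ku0 : Kdom H x ((u + 0) *: tau) by rewrite addr0.
have d1 : is_diff 0 (fun s => Kmap H x ((u + s) *: tau))
    (fun h => h *: ray_velocity x tau u).
  have ud : is_diff (0 : R) (fun s : R => u + s) (fun h : R => h).
    have := is_diffD (is_diff_cst u (0 : R)) (is_diff_id (0 : R)).
    by move=> /is_diff_eq; apply; rewrite add0r.
  have := is_diff_comp ud (is_diff_Kmap_ray Ku0).
  by rewrite addr0.
have d2 : is_diff 0 (fun s => Kmap H x (u *: tau) + Kmap H y (s *: sigma))
    (fun h => h *: 'd (Kmap H y) 0 sigma).
  have := is_diffD (is_diff_cst (Kmap H x (u *: tau)) 0) (is_diff_Kmap_ray Ky0).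
  by rewrite ray_velocity0 => /is_diff_eq; apply; rewrite add0r.
have d3 : is_diff 0 (fun s => Kmap H x ((u + s) *: tau))
    (fun h => h *: 'd (Kmap H y) 0 sigma).
  apply: near_eq_is_diff d2.
  by have := near_Kmap_line; apply: filterS => s [].
have := is_diff_unique (1 : R) d1 d3; rewrite !scale1r => ->.
exact: hmap_dK.
Qed.

(** The same relation read in the chart H_y centred at y, where the ray is a straight line. This
    form can be differentiated twice using the second derivative of H_y at 0. *)
Lemma near_H_line : \forall r \near u,
  [/\ Kdom H x (r *: tau), dfm_dom H (y, Kmap H x (r *: tau) - Kmap H x (u *: tau)) &
    H y (Kmap H x (r *: tau) - Kmap H x (u *: tau)) = (r - u) *: sigma].
Proof.
have Ky0 : Kdom H y (0 *: sigma) by rewrite scale0r; exact: Kdom0.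
have : \forall s \near 0,
  [/\ Kdom H x ((u + s) *: tau),
      dfm_dom H (y, Kmap H x ((u + s) *: tau) - Kmap H x (u *: tau)) &
    H y (Kmap H x ((u + s) *: tau) - Kmap H x (u *: tau)) = s *: sigma].
  have := near_ray_dom Ky0; have := near_Kmap_line.
  apply: filterS2 => s [Ks ->] Kys.
  by rewrite addrAC subrr add0r HK//; split => //; exact: Kmap_dom.
rewrite [X in _ -> X](near_shift 0) subr0; apply: filterS => s /=.
by rewrite addrK addrC.
Qed.

(** The second derivative at r = u of H_y(e(r) - e(u)) = (r - u) sigma. The right side is affine in
    r, and the left side gives h_y applied to the geodesic expression. *)
Lemma line_geodesic :
  D2H H y (ray_velocity x tau u) (ray_velocity x tau u) +
  hmap H y (ray_acceleration x tau u) = 0.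
Proof.
pose g r := Kmap H x (r *: tau) - Kmap H x (u *: tau).
have gd r : Kdom H x (r *: tau) -> is_diff r g (fun h => h *: ray_velocity x tau r).
  move=> Kr; have := is_diffB (is_diff_Kmap_ray Kr) (is_diff_cst (Kmap H x (u *: tau)) r).
  by move=> /is_diff_eq; apply; rewrite subr0.
have gu : g u = 0 by rewrite /g subrr.
have velocity : \forall r \near u, 'd (H y) (g r) (ray_velocity x tau r) = sigma.
  (* To differentiate at r the identity must hold around r, not only at r. *)
  have := near_join near_H_line; apply: filterS => r nr.
  have [Kr Dr _] := nbhs_singleton nr.
  have d1 := is_diff_comp (gd r Kr) (differentiableP (H_differentiable Dr)).
  have d2 : is_diff r (fun r => (r - u) *: sigma) (fun h => h *: sigma).
    have := is_diff_scale (is_diffB (is_diff_id r) (is_diff_cst u r)) (is_diff_cst sigma r).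
    by move=> /is_diff_eq; apply; rewrite funeqE => h /=; rewrite scaler0 addr0 subr0.
  have d3 : is_diff r (fun r => (r - u) *: sigma)
      ('d (H y) (g r) \o *:%R^~ (ray_velocity x tau r)).
    by apply: near_eq_is_diff d1; apply: filterS nr => v [].
  by have := is_diff_unique (1 : R) d3 d2; rewrite /= !scale1r.
have dHd v : differentiable (fun w => 'd (H y) w v) (g u).
  by rewrite gu; apply: dH_differentiable; exact: dfm_dom0.
have d1 := is_diff_dapp (rV_frame n) dHd (gd u Ku) (is_diff_ray_velocity Ku).
have d2 : is_diff u (fun r => 'd (H y) (g r) (ray_velocity x tau r))
    (fun h => h *: 0).
  have -> : (fun h : R => h *: (0 : V)) = fun=> 0.
    by rewrite funeqE => h; rewrite scaler0.
  apply: near_eq_is_diff (is_diff_cst sigma u).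
  by apply: filterS velocity => r ->.
by have := is_diff_curve_unique d1 d2; rewrite gu.
Qed.

End CanonicalLine.

End Rays.

(** * Local uniqueness for the equations solved by rays *)

Section Uniqueness.
Context {R : realType} {n : nat} (H : deformation R n).
Local Notation V := 'rV[R]_n.
Implicit Types (x y z t v w a b tau sigma : V) (u r s : R).
Local Notation F := (Hpair H).
Local Notation b2 := (prod_frame (rV_frame n) (rV_frame n)).

Lemma loclip_embed (y0 : V * V) : loclip (fun q : V * V => (q.1, 0 : V)) y0.
Proof. by apply: loclip_pair; [exact: loclip_fst|exact: loclip_cst]. Qed.

Lemma loclip_embed2 (y0 : V * V) : loclip (fun q : V * V => (0 : V, q.2)) y0.
Proof. by apply: loclip_pair; [exact: loclip_cst|exact: loclip_snd]. Qed.

Lemma loclip_dsmooth (f : V * V -> V) (y v : V) :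
  smooth_on (dfm_dom H) f -> dfm_base H y ->
  loclip (fun q : V * V => 'd f (q.1, 0) (0, q.2)) (y, v).
Proof.
move=> fs Xy.
apply: (@loclip_linear_family _ _ _ _ b2 (fun q : V * V => 'd f (q.1, 0 : V))
  (fun q => (0, q.2))); last exact: loclip_embed2.
move=> a; apply: (@loclip_comp _ _ _ _ (fun q : V * V => (q.1, 0 : V))
  (fun q => 'd f q a)); first exact: loclip_embed.
have [fd fc] := smooth_on_C1 (@dfm_dom_open _ _ H) (smooth_on_diff a fs) (dfm_dom0 Xy).
exact: (C1_loclip b2 fd fc).
Qed.

Lemma near_base1 (y v : V) : dfm_base H y -> \forall q \near (y, v), dfm_base H q.1.
Proof.
have c : q.1 @[q --> (y, v)] --> y by exact: cvg_fst.
by move=> /near_dfm_base Xy; exact: c _ Xy.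
Qed.

Lemma loclip_hmap y v : dfm_base H y -> loclip (fun q : V * V => hmap H q.1 q.2) (y, v).
Proof.
move=> Xy; apply: near_eq_loclip (loclip_dsmooth v (Hpair_smooth H) Xy).
by have := near_base1 v Xy; apply: filterS => q Xq; rewrite hmapE.
Qed.

(** Quadratic in the second component: one occurrence is expanded in the frame, which leaves terms
    linear in the other with smooth coefficients. *)
Lemma loclip_D2H y v : dfm_base H y ->
  loclip (fun q : V * V => D2H H q.1 q.2 q.2) (y, v).
Proof.
move=> Xy.
have Gl : loclip (fun q : V * V => \sum_(k : fr_index b2)
    fr_coord k (0, q.2) *: 'd (fun p => 'd F p (fr_vec k)) (q.1, 0) (0, q.2)) (y, v).
  apply: loclip_sum => k; apply: loclip_scale.
    exact/(loclip_comp (loclip_embed2 _))/loclip_linear/fr_coord_continuous.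
  by apply: loclip_dsmooth => //; exact/smooth_on_diff/Hpair_smooth.
apply: near_eq_loclip Gl; have := near_base1 v Xy.
apply: filterS => q Xq; rewrite D2HE//.
have Fd k : is_diff (q.1, 0) (fun p => 'd F p (@fr_vec _ _ b2 k))
    ('d (fun p => 'd F p (fr_vec k)) (q.1, 0)).
  apply: differentiableP.
  exact: smooth_on_differentiable (smooth_on_diff _ (Hpair_smooth H)) (dfm_dom0 Xq).
have dE := is_diff_sum (fun k : fr_index b2 => is_diffZ (fr_coord k (0, q.2)) (Fd k)).
have -> : (fun p => 'd F p (0, q.2)) =
    fun p => \sum_(k : fr_index b2) fr_coord k (0, q.2) *: 'd F p (fr_vec k).
  by rewrite funeqE => p; exact: linear_frame.
exact: esym (is_diffE (0, q.2) dE).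
Qed.

(** [k] bounds the inverse of h at y0. Where h_y differs from it by at most 1/(2k) in operator norm,
    half of |v| is absorbed and 2k remains. *)
Lemma hmap_lower y0 : dfm_base H y0 -> exists2 C, 0 < C &
  \forall y \near y0, forall v, `|v| <= C * `|hmap H y v|.
Proof.
move=> Xy.
have [k k0 kP] := linear_lipschitz (diff_continuous (Kmap_differentiable (Kdom0 Xy))).
have aux (A B : R) : A <= k * B + 2^-1 * A -> A <= 2 * k * B by move=> *; lra.
exists (2 * k); first exact: mulr_gt0.
have Lc v : 'd (H y) 0 v @[y --> y0] --> 'd (H y0) 0 v.
  have pl : loclip (fun y : V => (y, v)) y0.
    by apply: loclip_pair; [exact: loclip_id|exact: loclip_cst].
  exact: loclip_continuous (loclip_comp pl (loclip_hmap v Xy)).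
have e0 : 0 < (2 * k)^-1 by rewrite invr_gt0 mulr_gt0.
have := linear_family_near (rV_frame n) (L := fun y => 'd (H y) 0) Lc e0.
apply: filterS => y yP v.
have h0 : `|v| <= k * `|hmap H y0 v| by rewrite -{1}(dK_hmap v Xy).
have h1 : `|hmap H y0 v| <= `|hmap H y v| + (2 * k)^-1 * `|v|.
  rewrite -[hmap H y0 v](subrK (hmap H y v)) addrC (le_trans (ler_normD _ _))//.
  by rewrite lerD2l distrC; exact: yP.
have h2 : `|v| <= k * `|hmap H y v| + 2^-1 * `|v|.
  rewrite (le_trans h0)// (le_trans (ler_wpM2l (ltW k0) h1))// mulrDr lerD2l mulrA.
  by rewrite (_ : k * (2 * k)^-1 = 2^-1)//; field; rewrite gt_eqF.
exact: aux h2.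
Qed.

Section RayUniqueness.
Variables (x tau : V) (u : R) (c dc : R -> V).
Hypotheses (Ku : Kdom H x (u *: tau)) (Xu : dfm_base H (ray H x tau u)).
Hypothesis cu : c u = ray H x tau u.
Hypothesis c_diff : \forall r \near u, is_diff r c (fun h => h *: dc r).

Local Notation e := (ray H x tau).
Local Notation de := (ray_velocity H x tau).
Local Notation dde := (ray_acceleration H x tau).

Let cc : c r @[r --> u] --> e u.
Proof.
rewrite -cu; have [cd _] := nbhs_singleton c_diff.
exact: differentiable_continuous.
Qed.

Let ec : e r @[r --> u] --> e u. Proof. exact: ray_continuous. Qed.

Let dec : de r @[r --> u] --> de u. Proof. exact: ray_velocity_continuous. Qed.

Let near_pair (g : R -> V) w (P : V * V -> Prop) (c0 : R -> V) :
  c0 r @[r --> u] --> e u -> g r @[r --> u] --> w ->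
  (\forall q \near (e u, w), P q) -> \forall r \near u, P (c0 r, g r).
Proof. by move=> c0c gc; have pc := cvg_pair c0c gc; exact: pc. Qed.

(** h_c(c' - e') = h_e(e') - h_c(e') is Lipschitz in c - e, and the lower bound for h_c passes this
    on to c' - e'. *)
Lemma curve_eq_ray : (\forall r \near u, hmap H (c r) (dc r) = hmap H (e r) (de r)) ->
  \forall r \near u, c r = e r.
Proof.
move=> hE; have [C C0 CP] := hmap_lower Xu.
have CPc : \forall r \near u, forall v, `|v| <= C * `|hmap H (c r) v|.
  exact: cc _ CP.
have [K K0 [rho rho0 KP]] := loclip_hmap (de u) Xu.
have inball : \forall q \near (e u, de u), `|q - (e u, de u)| < rho.
  by apply/nbhs_normP; exists rho => //= q; rewrite distrC.
have b1 := near_pair cc dec inball.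
have b2 := near_pair ec dec inball.
suff : \forall r \near u, c r - e r = 0 /\ c r - e r = 0.
  by apply: filterS => r [/subr0_eq h1 _].
(* The equation is of first order, so both slots receive the same difference. *)
apply: (@ode_pair_zero R n (c - e) (c - e) (dc - de) (dc - de) u (C * K)).
- by rewrite -[LHS]/(c u - e u) cu subrr.
- by rewrite -[LHS]/(c u - e u) cu subrr.
near=> r.
have cr : is_diff r c (fun h => h *: dc r) by near: r.
have er : is_diff r e (fun h => h *: de r).
  by apply: is_diff_ray; near: r; exact: near_ray_dom.
have dr : is_diff r (c - e) (fun h => h *: (dc - de) r).
  have := is_diffB cr er; move=> /is_diff_eq; apply.
  by rewrite funeqE => h /=; rewrite scalerBr.
suff dB : `|(dc - de) r| <= C * K * (`|(c - e) r| + `|(c - e) r|) by split.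
have CPr : forall v, `|v| <= C * `|hmap H (c r) v| by near: r.
rewrite (le_trans (CPr _))// -mulrA ler_wpM2l ?(ltW C0)//.
have -> : hmap H (c r) ((dc - de) r) = hmap H (e r) (de r) - hmap H (c r) (de r).
  have hEr : hmap H (c r) (dc r) = hmap H (e r) (de r) by near: r.
  by rewrite -hEr /hmap -linearB.
have b1r : `|(c r, de r) - (e u, de u)| < rho by near: r.
have b2r : `|(e r, de r) - (e u, de u)| < rho by near: r.
rewrite (le_trans (KP _ _ b2r b1r))// ler_wpM2l// prod_normE /= subrr normr0.
by rewrite (max_idPl _)// distrC lerDl.
Unshelve. all: by end_near. Qed.

Lemma geodesic_eq_ray (ddc : R -> V) : dc u = de u ->
  (\forall r \near u, is_diff r dc (fun h => h *: ddc r)) ->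
  (\forall r \near u, D2H H (c r) (dc r) (dc r) + hmap H (c r) (ddc r) = 0) ->
  (\forall r \near u, D2H H (e r) (de r) (de r) + hmap H (e r) (dde r) = 0) ->
  \forall r \near u, c r = e r /\ dc r = de r.
Proof.
move=> dcu dc_diff cgeo egeo; have [C C0 CP] := hmap_lower Xu.
have CPc : \forall r \near u, forall v, `|v| <= C * `|hmap H (c r) v|.
  exact: cc _ CP.
have dcc : dc r @[r --> u] --> de u.
  rewrite -dcu; have [cd _] := nbhs_singleton dc_diff.
  exact: differentiable_continuous.
have ddec : dde r @[r --> u] --> dde u by exact: ray_acceleration_continuous.
have [K K0 [rho rho0 KP]] := loclip_hmap (dde u) Xu.
have [L L0 [rho' rho'0 LP]] := loclip_D2H (de u) Xu.
have inball (w : V) d : 0 < d -> \forall q \near (e u, w), `|q - (e u, w)| < d.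
  by move=> d0; apply/nbhs_normP; exists d => //= q; rewrite distrC.
have b1 := near_pair cc ddec (inball _ _ rho0).
have b2 := near_pair ec ddec (inball _ _ rho0).
have b3 := near_pair cc dcc (inball _ _ rho'0).
have b4 := near_pair ec dec (inball _ _ rho'0).
suff : \forall r \near u, c r - e r = 0 /\ dc r - de r = 0.
  by apply: filterS => r [/subr0_eq h1 /subr0_eq h2].
(* The summand 1 serves the first slot, whose derivative is the second function itself; C (K + L)
   serves the second slot. *)
apply: (@ode_pair_zero R n (c - e) (dc - de) (dc - de) (ddc - dde) u (C * (K + L) + 1)).
- by rewrite -[LHS]/(c u - e u) cu subrr.
- by rewrite -[LHS]/(dc u - de u) dcu subrr.
near=> r.
have CKL : 0 <= C * (K + L) by rewrite mulr_ge0 ?addr_ge0// ltW.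
have Kr : Kdom H x (r *: tau) by near: r; exact: near_ray_dom.
have cr : is_diff r c (fun h => h *: dc r) by near: r.
have dcr : is_diff r dc (fun h => h *: ddc r) by near: r.
have d1 : is_diff r (c - e) (fun h => h *: (dc - de) r).
  have := is_diffB cr (is_diff_ray Kr); move=> /is_diff_eq; apply.
  by rewrite funeqE => h /=; rewrite scalerBr.
have d2 : is_diff r (dc - de) (fun h => h *: (ddc - dde) r).
  have := is_diffB dcr (is_diff_ray_velocity Kr); move=> /is_diff_eq; apply.
  by rewrite funeqE => h /=; rewrite scalerBr.
set N := `|(c - e) r| + `|(dc - de) r|.
have N0 : 0 <= N by rewrite addr_ge0.
split => //.
  have dN : `|(dc - de) r| <= N by rewrite lerDr.
  by rewrite mulrDl mul1r (le_trans dN)// lerDr mulr_ge0.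
have CPr : forall v, `|v| <= C * `|hmap H (c r) v| by near: r.
apply: (@le_trans _ _ (C * (K + L) * N)); last by rewrite ler_wpM2r// lerDl.
rewrite (le_trans (CPr _))// -mulrA ler_wpM2l ?(ltW C0)//.
(* Both equations are used to eliminate c'': what remains is h at a fixed vector e'' and two base
   points, plus a difference of the quadratic terms, each covered by a Lipschitz bound. *)
have -> : hmap H (c r) ((ddc - dde) r) =
    (hmap H (e r) (dde r) - hmap H (c r) (dde r)) +
    (D2H H (e r) (de r) (de r) - D2H H (c r) (dc r) (dc r)).
  have cg : D2H H (c r) (dc r) (dc r) + hmap H (c r) (ddc r) = 0 by near: r.
  have eg : D2H H (e r) (de r) (de r) + hmap H (e r) (dde r) = 0 by near: r.
  have -> : hmap H (c r) ((ddc - dde) r) = hmap H (c r) (ddc r) - hmap H (c r) (dde r).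
    by rewrite /hmap -linearB.
  have alg (A B D E G : V) : A + B = 0 -> D + E = 0 -> B - G = (E - G) + (D - A).
    by move=> /addr0_eq<- /addr0_eq<-; rewrite [RHS]addrACA addNr add0r addrC.
  exact: alg cg eg.
have b1r : `|(c r, dde r) - (e u, dde u)| < rho by near: r.
have b2r : `|(e r, dde r) - (e u, dde u)| < rho by near: r.
have b3r : `|(c r, dc r) - (e u, de u)| < rho' by near: r.
have b4r : `|(e r, de r) - (e u, de u)| < rho' by near: r.
rewrite (le_trans (ler_normD _ _))// mulrDl lerD//.
  rewrite (le_trans (KP _ _ b2r b1r))// ler_wpM2l// prod_normE /= subrr normr0.
  by rewrite (max_idPl _)// distrC lerDl.
rewrite (le_trans (LP _ _ b4r b3r))// ler_wpM2l// prod_normE /= ge_max.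
by rewrite distrC lerDl normr_ge0 distrC lerDr normr_ge0.
Unshelve. all: by end_near. Qed.

End RayUniqueness.

End Uniqueness.
(** * Canonical deformations *)

Section Canonical.
Context {R : realType} {n : nat} (H : deformation R n).
Hypothesis H_close : close_points H.
Local Notation V := 'rV[R]_n.
Implicit Types (x y z t v w a b tau sigma : V) (u r s : R) (J : set R) (c : R -> V).

Lemma is_diff_curve c u : differentiable c u -> is_diff u c (fun h => h *: derive1 c u).
Proof.
move=> cd; have := differentiableP cd; move=> /is_diff_eq; apply.
by rewrite funeqE => h; rewrite derive1E'// -linearZ /= [h *: 1]mulr1.
Qed.

Lemma smooth_derive1 J c u : open J -> smooth_on J c -> J u ->
  differentiable (derive1 c) u.
Proof.
move=> oJ cs Ju.
have d1 : differentiable (fun r => 'd c r 1) u.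
  exact: (smooth_on_differentiable (smooth_on_diff (1 : R) cs) Ju).
have : is_diff u (derive1 c) ('d (fun r => 'd c r 1) u).
  apply: near_eq_is_diff (differentiableP d1).
  have : \forall r \near u, J r by exact: open_nbhs_nbhs (conj oJ Ju).
  by apply: filterS => r Jr; rewrite derive1E'//; exact: smooth_on_differentiable cs Jr.
by case.
Qed.

(** The equation H_x(c(u) - x) = u tau makes sense at every point of the curve by [H_close], and
    membership of u tau in the domain of K_x follows from it rather than having to be carried
    along. *)
Lemma close_ray x c u tau : dfm_base H x -> dfm_base H (c u) ->
  H x (c u - x) = u *: tau -> Kdom H x (u *: tau) /\ c u = ray H x tau u.
Proof.
move=> Xx Xcu Hu; have Dcu := H_close Xx Xcu.
split; first by rewrite -Hu; exact: Kdom_H.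
by rewrite /ray /translate -Hu KH// addrC subrK.
Qed.

Lemma H_ray x tau u : Kdom H x (u *: tau) -> H x (ray H x tau u - x) = u *: tau.
Proof. by move=> Ku; rewrite /ray /translate addrAC subrr add0r HK. Qed.

Lemma near_not_ray x c u tau : dfm_base H x -> dfm_base H (c u) ->
  {for u, continuous c} -> H x (c u - x) <> u *: tau ->
  \forall r \near u, H x (c r - x) <> r *: tau.
Proof.
move=> Xx Xcu cc /eqP; rewrite -subr_eq0 => neq.
have Hc := differentiable_continuous (H_differentiable (H_close Xx Xcu)).
have cx : (c r - x) @[r --> u] --> c u - x by apply: cvgB; [exact: cc|exact: cvg_cst].
have h1 : H x (c r - x) @[r --> u] --> H x (c u - x) by exact: (cvg_comp _ _ cx Hc).
have h2 : r *: tau @[r --> u] --> u *: tau by exact: scalel_continuous.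
have dc : H x (c r - x) - r *: tau @[r --> u] --> H x (c u - x) - u *: tau.
  exact: cvgB h1 h2.
have : \forall r \near u, H x (c r - x) - r *: tau != 0 by exact: cvgr_neq0 dc neq.
by apply: filterS => r; rewrite subr_eq0 => /eqP.
Qed.

Lemma near_base_ray x tau u : Kdom H x (u *: tau) -> dfm_base H (ray H x tau u) ->
  \forall r \near u, dfm_base H (ray H x tau r).
Proof. by move=> Ku /near_dfm_base Xu; exact: ray_continuous Ku _ Xu. Qed.

(* Differentiating the canonical relation in s' at 0 shows that c and the ray
   u |-> x + K_x (u tau) solve the same equation h_y y' = w(u), so they agree
   near each common point; H_close makes the set of common points closed. *)
Lemma canonical_curve_ray x J c : dfm_base H x -> curve_in H J c -> J 0 -> c 0 = x ->
  (forall s s', J s -> phi_dom H x (s *: tau H c 0) (s' *: tau H c s) ->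
     phi H x (s *: tau H c 0) (s' *: tau H c s) = (s + s') *: tau H c 0) ->
  forall u, J u -> Kdom H x (u *: tau H c 0) /\ c u = ray H x (tau H c 0) u.
Proof.
move=> Xx [oJ iJ cs cX] J0 c0 canon; set tau0 := tau H c 0 in canon *.
have Jnear u : J u -> \forall r \near u, J r.
  by move=> Ju; exact: open_nbhs_nbhs (conj oJ Ju).
have cd u : J u -> differentiable c u by move=> Ju; exact: smooth_on_differentiable cs Ju.
suff HP : forall u, J u -> H x (c u - x) = u *: tau0.
  by move=> u Ju; apply: close_ray => //; [exact: cX|exact: HP].
apply: (open_interval_ind oJ iJ J0).
- by rewrite c0 subrr scale0r; exact: dfm_map0.
- move=> u Ju Hu; have [Ku cu] := close_ray Xx (cX u Ju) Hu.
  have Xu : dfm_base H (ray H x tau0 u) by rewrite -cu; exact: cX.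
  have c_diff : \forall r \near u, is_diff r c (fun h => h *: derive1 c r).
    by have := Jnear u Ju; apply: filterS => r Jr; exact/is_diff_curve/cd.
  have hE : \forall r \near u,
      hmap H (c r) (derive1 c r) = hmap H (ray H x tau0 r) (ray_velocity H x tau0 r).
    have := near_base_ray Ku Xu; have := near_ray_dom Ku; have := Jnear u Ju.
    apply: filterS3 => r Jr Kr Xr.
    by rewrite (line_velocity (sigma := tau H c r) Kr Xr)// => s; exact: canon.
  have := near_ray_dom Ku; have := curve_eq_ray Ku Xu cu c_diff hE.
  by apply: filterS2 => r -> Kr; exact: H_ray.
- move=> u Ju; apply: near_not_ray => //; first exact: cX.
  exact: differentiable_continuous (cd u Ju).
Qed.

Hypothesis H_canonical : canonical_deformation H.

(** Canonicity for the points x and e(u) yields a curve [c] reaching e(u) at a parameter [s1]. As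
    [c] is itself a ray, u v equals s1 times its initial vector, and rescaling by u / s1 gives the
    relation for v. *)
Lemma phi_ray x v u s : Kdom H x (u *: v) -> dfm_base H (ray H x v u) ->
  phi_dom H x (u *: v) (s *: hmap H (ray H x v u) (ray_velocity H x v u)) ->
  phi H x (u *: v) (s *: hmap H (ray H x v u) (ray_velocity H x v u)) =
    (u + s) *: v.
Proof.
move=> Ku Xu; have Xx := Kdom_base Ku.
(* If u or v is zero the two points coincide and the curve determines no direction; then phi_x(0, t)
   = t settles the claim. *)
have [->|u0] := eqVneq u 0.
  rewrite ray0// ray_velocity0 hmap_dK// scale0r add0r => -[_ + _].
  by rewrite /translate Kmap0// addr0 => Ks; exact: phi0l.
have [->|tau0] := eqVneq v 0.
  move=> _; have -> : ray_velocity H x 0 u = 0 by exact: linear0.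
  have -> : hmap H (ray H x 0 u) 0 = 0 by exact: linear0.
  by rewrite !scaler0 phi0l//; exact: Kdom0.
have [J [c [cJ [J0 c0] [s1 Js1 cs1] canon]]] := H_canonical Xx Xu.
have cray := canonical_curve_ray Xx cJ J0 c0 canon.
have [Ks1 cs1E] := cray s1 Js1.
have utau : u *: v = s1 *: tau H c 0.
  by rewrite -(H_ray Ku) -(H_ray Ks1) -cs1E cs1.
have s10 : s1 != 0.
  apply/eqP => s10; move/eqP: utau; rewrite s10 scale0r scaler_eq0.
  by rewrite (negPf u0) (negPf tau0).
have tauE : tau H c 0 = (u / s1) *: v.
  by rewrite mulrC -scalerA utau scalerA mulVf ?scale1r.
have [oJ _ cs _] := cJ.
have dcs1 : derive1 c s1 = (u / s1) *: ray_velocity H x v u.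
  have rd := is_diff_ray Ks1.
  have cd : is_diff s1 c (fun h => h *: ray_velocity H x (tau H c 0) s1).
    apply: near_eq_is_diff rd.
    have : \forall r \near s1, J r by exact: open_nbhs_nbhs (conj oJ Js1).
    by apply: filterS => r /cray[].
  have cd' := is_diff_curve (smooth_on_differentiable cs Js1).
  have := is_diff_unique (1 : R) cd' cd; rewrite !scale1r => ->.
  by rewrite /ray_velocity -utau tauE linearZ.
have tau1 : tau H c s1 = (u / s1) *: hmap H (ray H x v u) (ray_velocity H x v u).
  by rewrite /tau dcs1 cs1 /hmap linearZ.
(* In the parameter of [c] the increment s becomes s s1 / u, and (s1 + s s1 / u)(u / s1) = u + s. *)
have -> : s *: hmap H (ray H x v u) (ray_velocity H x v u) =
    (s * s1 / u) *: tau H c s1.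
  by rewrite tau1 scalerA mulrA divfK// mulfK.
rewrite utau => /canon ->//; rewrite tauE scalerA; congr (_ *: _).
by field; apply/andP.
Qed.

Lemma ray_geodesic x tau u : Kdom H x (u *: tau) -> dfm_base H (ray H x tau u) ->
  D2H H (ray H x tau u) (ray_velocity H x tau u) (ray_velocity H x tau u) +
  hmap H (ray H x tau u) (ray_acceleration H x tau u) = 0.
Proof. by move=> Ku Xu; apply: (line_geodesic Ku Xu) => s; exact: phi_ray. Qed.

(** The equation has second order, so the property propagated along [J] is agreement of position and
    velocity together. *)
Lemma geodesic_ray x J c : dfm_base H x -> geodesic H J c -> J 0 -> c 0 = x ->
  forall u, J u -> [/\ Kdom H x (u *: tau H c 0), c u = ray H x (tau H c 0) u &
    derive1 c u = ray_velocity H x (tau H c 0) u].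
Proof.
move=> Xx [[oJ iJ cs cX] geo] J0 c0; set tau0 := tau H c 0.
have Jnear u : J u -> \forall r \near u, J r.
  by move=> Ju; exact: open_nbhs_nbhs (conj oJ Ju).
have cd u : J u -> differentiable c u by move=> Ju; exact: smooth_on_differentiable cs Ju.
have dcd u : J u -> differentiable (derive1 c) u by exact: smooth_derive1 oJ cs.
suff HP : forall u, J u ->
    H x (c u - x) = u *: tau0 /\ derive1 c u = ray_velocity H x tau0 u.
  move=> u Ju; have [Hu du] := HP u Ju.
  by have [Ku cu] := close_ray Xx (cX u Ju) Hu.
apply: (open_interval_ind oJ iJ J0).
- split; first by rewrite c0 subrr scale0r; exact: dfm_map0.
  by rewrite ray_velocity0 /tau0 /tau c0 dK_hmap.
- move=> u Ju [Hu du]; have [Ku cu] := close_ray Xx (cX u Ju) Hu.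
  have Xu : dfm_base H (ray H x tau0 u) by rewrite -cu; exact: cX.
  have c_diff : \forall r \near u, is_diff r c (fun h => h *: derive1 c r).
    by have := Jnear u Ju; apply: filterS => r Jr; exact/is_diff_curve/cd.
  have dc_diff : \forall r \near u,
      is_diff r (derive1 c) (fun h => h *: derive1 (derive1 c) r).
    by have := Jnear u Ju; apply: filterS => r Jr; exact/is_diff_curve/dcd.
  have cgeo : \forall r \near u, D2H H (c r) (derive1 c r) (derive1 c r) +
      hmap H (c r) (derive1 (derive1 c) r) = 0.
    have := Jnear u Ju; apply: filterS => r Jr; have Xr := cX r Jr.
    (* Since h k = id, the expression is h applied to the left side of the geodesic equation. *)
    rewrite -[D2H _ _ _ _](hmap_kmap _ Xr) /hmap -linearD addrC geo//.
    by rewrite linear0.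
  have egeo : \forall r \near u, D2H H (ray H x tau0 r) (ray_velocity H x tau0 r)
      (ray_velocity H x tau0 r) + hmap H (ray H x tau0 r) (ray_acceleration H x tau0 r) = 0.
    have := near_base_ray Ku Xu; have := near_ray_dom Ku.
    by apply: filterS2 => r Kr Xr; exact: ray_geodesic.
  have := geodesic_eq_ray Ku Xu cu c_diff du dc_diff cgeo egeo.
  have := near_ray_dom Ku; apply: filterS2 => r Kr [-> ->].
  exact: (conj (H_ray Kr) erefl).
(* Velocities can be compared by continuity only where the ray is defined, which needs equal
   positions; unequal positions are treated separately. *)
- move=> u Ju; have [Hu NP|NH _] := pselect (H x (c u - x) = u *: tau0); last first.
    have := near_not_ray Xx (cX u Ju) (differentiable_continuous (cd u Ju)) NH.
    by apply: filterS => r NHr [].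
  have [Ku cu] := close_ray Xx (cX u Ju) Hu.
  have neq : derive1 c u - ray_velocity H x tau0 u != 0.
    by rewrite subr_eq0; apply/eqP => du; exact: NP.
  have dcc := differentiable_continuous (dcd u Ju).
  have rvc := ray_velocity_continuous Ku.
  have dv : derive1 c r - ray_velocity H x tau0 r @[r --> u] -->
      derive1 c u - ray_velocity H x tau0 u by exact: cvgB dcc rvc.
  have : \forall r \near u, derive1 c r - ray_velocity H x tau0 r != 0.
    exact: cvgr_neq0 dv neq.
  by apply: filterS => r; rewrite subr_eq0 => /eqP rneq [_ dr].
Qed.

End Canonical.

(** * Joint differentiability of the group law *)

Section JointDifferentiability.
Context {R : realType} {n : nat} (H : deformation R n).
Local Notation V := 'rV[R]_n.
Implicit Types (x y z t v w a b tau sigma : V) (u r s : R).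
Local Notation F := (Hpair H).
Local Notation b2 := (prod_frame (rV_frame n) (rV_frame n)).
Local Notation K := (fun q : V * V => Kmap H q.1 q.2).
Local Notation Phi x := (fun q : V * V => phi H x q.1 q.2).

Lemma is_diff_fst (p : V * V) : is_diff p fst fst.
Proof.
have fc : continuous (fst : V * V -> V) by move=> q; exact: cvg_fst.
by apply: DiffDef; [exact: linear_differentiable|rewrite diff_lin].
Qed.

Lemma is_diff_snd (p : V * V) : is_diff p snd snd.
Proof.
have fc : continuous (snd : V * V -> V) by move=> q; exact: cvg_snd.
by apply: DiffDef; [exact: linear_differentiable|rewrite diff_lin].
Qed.

(** The iteration solves H_y(z) = t with z near K_{y0}(t0), and injectivity of H_y identifies z with
    K_y(t). Openness of the joint domain and continuity come out together. *)
Lemma Kmap_near y0 t0 : Kdom H y0 t0 -> forall e, 0 < e ->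
  \forall q \near (y0, t0), Kdom H q.1 q.2 /\ `|K q - Kmap H y0 t0| <= e.
Proof.
move=> K0 e e0; have D0 := Kmap_dom K0; set z0 := Kmap H y0 t0 in D0 *.
have F0 : F (y0, z0) = t0 by exact: HK.
have /nbhs_normP[d /= d0 dD] := near_dfm_dom D0.
have [Fd Fc] := smooth_on_C1 (@dfm_dom_open _ _ H) (Hpair_smooth H) D0.
have Mc : continuous ('d (Kmap H y0) t0) by exact/diff_continuous/Kmap_differentiable.
have MS v : 'd (Kmap H y0) t0 ('d F (y0, z0) (0, v)) = v.
  by rewrite -(dHE v D0) -F0; exact: dK_dH.
have SM v : 'd F (y0, z0) (0, 'd (Kmap H y0) t0 v) = v.
  exact: etrans (esym (dHE _ D0)) (dH_dK v K0).
(* The solution is only weakly bounded, so d/2 keeps (y, z) strictly inside the ball contained in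
   [dfm_dom]. *)
have e'0 : 0 < Num.min e (d / 2) by rewrite lt_min e0 divr_gt0.
have [r r0 rP] := local_solve (rV_frame n) Fd Fc Mc MS SM e'0.
apply/nbhs_normP; exists (Num.min r d) => [|[y t]] /=; first by rewrite lt_min r0.
rewrite prod_normE /= num_gt_max /= !lt_min => /andP[/andP[yr yd] /andP[tr td]].
have [||z ze Fz] := rP y t; first by rewrite distrC.
  by rewrite F0 distrC.
move: ze; rewrite le_min => /andP[ze zd].
have Dyz : dfm_dom H (y, z).
  apply: dD; rewrite /= prod_normE /= num_gt_max /= yd /= distrC.
  by rewrite (le_lt_trans zd)// ltr_pdivrMr// ltr_pMr// ltr1n.
have Hz : H y z = t by exact: Fz.
by rewrite -Hz KH//; split => //; exact: Kdom_H.
Qed.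

Lemma near_Kdom_pair y0 t0 : Kdom H y0 t0 -> \forall q \near (y0, t0), Kdom H q.1 q.2.
Proof. by move=> K0; have := Kmap_near K0 ltr01; apply: filterS => q []. Qed.

Lemma Kmap_pair_continuous y0 t0 : Kdom H y0 t0 -> {for (y0, t0), continuous K}.
Proof.
move=> K0; apply/cvgrPdist_le => e /(Kmap_near K0).
by apply: filterS => q [_]; rewrite distrC.
Qed.

Lemma Kmap_pair_differentiable y0 t0 : Kdom H y0 t0 -> differentiable K (y0, t0).
Proof.
move=> K0; have D0 := Kmap_dom K0.
have F0 : F (y0, Kmap H y0 t0) = t0 by exact: HK.
have := @implicit_differentiable R V V V F K y0 (Kmap H y0 t0) ('d (Kmap H y0) t0).
rewrite F0; apply => //.
- exact: Hpair_differentiable.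
- exact/diff_continuous/Kmap_differentiable.
- by move=> v; rewrite -(dHE v D0) -[RHS](dK_dH v D0) HK.
- exact: Kmap_pair_continuous.
- by have := near_Kdom_pair K0; apply: filterS => q Kq; exact: HK.
Qed.

Lemma phi_pair_differentiable x t t' : phi_dom H x t t' -> differentiable (Phi x) (t, t').
Proof.
move=> [Kt Kt' Dx]; rewrite dfm_domE in Dx.
have f1 := is_diff_fst (t, t'); have f2 := is_diff_snd (t, t').
have k1 : is_diff (t, t') (fun q : V * V => Kmap H x q.1) ('d (Kmap H x) t \o fst).
  exact: (is_diff_comp f1 (differentiableP (Kmap_differentiable Kt))).
have k2 := is_diff_comp (is_diff_pair (is_diffD (is_diff_cst x (t, t')) k1) f2)
  (differentiableP (Kmap_pair_differentiable Kt')).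
by have [] := is_diff_comp (is_diffD k1 k2) (differentiableP (H_differentiable Dx)).
Qed.

Lemma near_phi_dom x t t' : phi_dom H x t t' ->
  \forall q \near (t, t'), phi_dom H x q.1 q.2.
Proof.
move=> [Kt Kt' Dx]; rewrite dfm_domE in Dx.
have f1 := is_diff_fst (t, t'); have f2 := is_diff_snd (t, t').
have k1 : is_diff (t, t') (fun q : V * V => Kmap H x q.1) ('d (Kmap H x) t \o fst).
  exact: (is_diff_comp f1 (differentiableP (Kmap_differentiable Kt))).
have tr := is_diff_pair (is_diffD (is_diff_cst x (t, t')) k1) f2.
have k2 := is_diff_comp tr (differentiableP (Kmap_pair_differentiable Kt')).
have c1 : {for (t, t'), continuous (fst : V * V -> V)} by exact: cvg_fst.
have c2 := differentiable_continuous (@ex_diff _ _ _ _ _ _ _ tr).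
have c3 := differentiable_continuous (@ex_diff _ _ _ _ _ _ _ (is_diffD k1 k2)).
have n1 : \forall q \near (t, t'), Kdom H x q.1 by exact: c1 _ (near_Kdom Kt).
have n2 : \forall q \near (t, t'), Kdom H (translate H x q.1) q.2.
  exact: c2 _ (near_Kdom_pair Kt').
have n3 : \forall q \near (t, t'),
    dfm_dom H (x, Kmap H x q.1 + Kmap H (translate H x q.1) q.2).
  exact: c3 _ (near_section Dx).
near=> q; split; [by near: q|by near: q|].
by rewrite dfm_domE; near: q.
Unshelve. all: by end_near. Qed.

Lemma is_diff_phi_l x t t' : phi_dom H x t t' ->
  is_diff t (fun a => phi H x a t') (fun a => 'd (Phi x) (t, t') (a, 0)).
Proof.
move=> D; exact: (is_diff_comp (is_diff_pair (is_diff_id t) (is_diff_cst t' t))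
  (differentiableP (phi_pair_differentiable D))).
Qed.

Lemma is_diff_phi_r x t t' : phi_dom H x t t' ->
  is_diff t' (phi H x t) (fun b => 'd (Phi x) (t, t') (0, b)).
Proof.
move=> D; exact: (is_diff_comp (is_diff_pair (is_diff_cst t t') (is_diff_id t'))
  (differentiableP (phi_pair_differentiable D))).
Qed.

Lemma phi_dom_r0 x t : Kdom H x t -> dfm_base H (translate H x t) -> phi_dom H x t 0.
Proof.
move=> Kt Xt; split => //; first exact: Kdom0.
by rewrite dfm_domE Kmap0// addr0; exact: Kmap_dom.
Qed.

Lemma phi_dom_l0 x t : Kdom H x t -> phi_dom H x 0 t.
Proof.
move=> Kt; have Xx := Kdom_base Kt; split; first exact: Kdom0.
  by rewrite /translate Kmap0// addr0.
by rewrite dfm_domE /translate Kmap0// addr0 add0r; exact: Kmap_dom.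
Qed.

Lemma is_diff_phi0 x t : Kdom H x t -> is_diff t (phi H x 0) id.
Proof.
move=> Kt; apply: near_eq_is_diff (is_diff_id t).
by have := near_Kdom Kt; apply: filterS => w Kw; rewrite phi0l//; exact: Kdom_base Kt.
Qed.

Lemma hmap_pair_differentiable y v : dfm_base H y ->
  is_diff (y, v) (fun q : V * V => hmap H q.1 q.2)
    (fun q => 'd (fun p => 'd F p (0, v)) (y, 0) (q.1, 0) + 'd F (y, 0) (0, q.2)).
Proof.
move=> Xy; have f1 := is_diff_fst (y, v); have f2 := is_diff_snd (y, v).
have u1 := is_diff_pair f1 (is_diff_cst (0 : V) (y, v)).
have u2 := is_diff_pair (is_diff_cst (0 : V) (y, v)) f2.
have Fd (a : V * V) : differentiable (fun q => 'd F q a) (y, 0).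
  exact: smooth_on_differentiable (smooth_on_diff _ (Hpair_smooth H)) (dfm_dom0 Xy).
have := is_diff_dapp b2 Fd u1 u2.
apply: near_eq_is_diff.
by have := near_base1 v Xy; apply: filterS => q Xq; rewrite hmapE.
Qed.

(** First-order regularity of K_y(t) in (y, t) does not reach the derivative of K_y as y varies. The
    latter is obtained as the solution z of h_y(z) = w; [hmap_lower] gives its continuity. *)
Lemma dK0_pair_differentiable x z : dfm_base H x ->
  differentiable (fun q : V * V => 'd (Kmap H q.1) 0 q.2) (x, hmap H x z).
Proof.
move=> Xx; pose g (q : V * V) := 'd (Kmap H q.1) 0 q.2.
have hd := hmap_pair_differentiable z Xx.
have [C C0 CP] := hmap_lower Xx.
have gz : g (x, hmap H x z) = z by exact: dK_hmap.
have gc : {for (x, hmap H x z), continuous g}.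
  apply/cvgrPdist_le => e e0; rewrite gz.
  have eC : 0 < e / C by rewrite divr_gt0.
  have c2 : {for (x, hmap H x z), continuous (snd : V * V -> V)} by exact: cvg_snd.
  have c1 : {for (x, hmap H x z), continuous (fun q : V * V => hmap H q.1 z)}.
    have pl : loclip (fun q : V * V => (q.1, z)) (x, hmap H x z).
      by apply: loclip_pair; [exact: loclip_fst|exact: loclip_cst].
    exact: loclip_continuous (loclip_comp pl (loclip_hmap z Xx)).
  have : q.2 - hmap H q.1 z @[q --> (x, hmap H x z)] --> hmap H x z - hmap H x z.
    exact: cvgB c2 c1.
  rewrite subrr => /cvgr0Pnorm_le/(_ _ eC) small.
  have fc : {for (x, hmap H x z), continuous (fst : V * V -> V)} by exact: cvg_fst.
  have n1 := near_base1 (hmap H x z) Xx.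
  have n2 : \forall q \near (x, hmap H x z), forall v, `|v| <= C * `|hmap H q.1 v|.
    exact: fc _ CP.
  near=> q; rewrite distrC.
  have Xq : dfm_base H q.1 by near: q.
  have nq : forall v, `|v| <= C * `|hmap H q.1 v| by near: q.
  rewrite (le_trans (nq _))//.
  have -> : hmap H q.1 (g q - z) = hmap H q.1 (g q) - hmap H q.1 z by exact: linearB.
  have -> : hmap H q.1 (g q) = q.2 by exact: hmap_dK.
  by rewrite -ler_pdivlMl// mulrC; near: q.
apply: (@implicit_differentiable R V V V (fun q => hmap H q.1 q.2) g x z
  ('d (Kmap H x) 0) _ _ _ gz gc).
- by case: hd.
- exact/diff_continuous/Kmap_differentiable/Kdom0.
- move=> v; have -> : 'd (fun q : V * V => hmap H q.1 q.2) (x, z) (0, v) = hmap H x v.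
    have E2 : 'd (fun p => 'd F p (0, z)) (x, 0) (0, 0) = 0 by exact: linear0.
    apply: etrans (is_diffE (0, v) hd) _.
    apply: etrans (congr1 (fun w => w + _) E2) _.
    exact: etrans (add0r _) (esym (hmapE v Xx)).
  exact: dK_hmap.
- by have := near_base1 (hmap H x z) Xx; apply: filterS => q Xq; exact: hmap_dK.
Unshelve. all: by end_near. Qed.

Lemma dK0_differentiable x b : dfm_base H x ->
  differentiable (fun y => 'd (Kmap H y) 0 b) x.
Proof.
move=> Xx; have gd := dK0_pair_differentiable ('d (Kmap H x) 0 b) Xx.
rewrite hmap_dK// in gd.
by have [] := is_diff_comp (is_diff_pair (is_diff_id x) (is_diff_cst b x))
  (differentiableP gd).
Qed.

(** The chain rule at t' = 0 factors lambda into a derivative of H_x and the derivative of K at the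
    translated point, which exposes its dependence on t. *)
Lemma lambdaE x t b : Kdom H x t -> dfm_base H (translate H x t) ->
  lambda H x t b = 'd (H x) (Kmap H x t) ('d (Kmap H (translate H x t)) 0 b).
Proof.
move=> Kt Xt; have K0 := Kmap_differentiable (Kdom0 Xt).
have K00 : Kmap H x t + Kmap H (translate H x t) 0 = Kmap H x t.
  by rewrite Kmap0// addr0.
have Hd : differentiable (H x) (Kmap H x t + Kmap H (translate H x t) 0).
  by rewrite K00; exact/H_differentiable/Kmap_dom.
have sumd := is_diffD (is_diff_cst (Kmap H x t) 0) (differentiableP K0).
have := is_diffE b (is_diff_comp sumd (differentiableP Hd)).
by rewrite K00 add0r.
Qed.

(** [gamma] is a ['d] of this map, so rules of calculus apply to it only once differentiability is
    known. *)
Lemma lambda_differentiable x b : dfm_base H x ->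
  differentiable (fun t => lambda H x t b) 0.
Proof.
move=> Xx; have Kd := differentiableP (Kmap_differentiable (Kdom0 Xx)).
have trd := is_diffD (is_diff_cst x 0) Kd.
have tr0 : (cst x + Kmap H x) 0 = x by rewrite -[LHS]/(x + Kmap H x 0) Kmap0// addr0.
have dKd : differentiable (fun y => 'd (Kmap H y) 0 b) ((cst x + Kmap H x) 0).
  by rewrite tr0; exact: dK0_differentiable.
have wd := is_diff_comp trd (differentiableP dKd).
have Hd v : differentiable (fun w => 'd (H x) w v) (Kmap H x 0).
  by rewrite Kmap0//; exact/dH_differentiable/dfm_dom0.
have ld := is_diff_dapp (rV_frame n) Hd Kd wd.
have trc := differentiable_continuous (@ex_diff _ _ _ _ _ _ _ trd).
have n1 : \forall t \near 0, dfm_base H (translate H x t).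
  by apply: (trc [set y | dfm_base H y]); rewrite tr0; exact: near_dfm_base.
apply: (@ex_diff _ _ _ _ _ _ _ (near_eq_is_diff _ ld)).
have := near_Kdom (Kdom0 Xx); apply: filterS2 n1 => t Xt Kt.
by rewrite lambdaE.
Qed.

End JointDifferentiability.

(** * The two formulas along a ray *)

Section RayIdentities.
Context {R : realType} {n : nat} (H : deformation R n).
Hypotheses (H_close : close_points H) (H_canonical : canonical_deformation H).
Local Notation V := 'rV[R]_n.
Implicit Types (x y z t v w a b : V) (u r s : R).
Local Notation Phi x := (fun q : V * V => phi H x q.1 q.2).

Definition ray_tau x v u : V := hmap H (ray H x v u) (ray_velocity H x v u).

Lemma ray_tau0 x v : dfm_base H x -> ray_tau x v 0 = v.
Proof. by move=> Xx; rewrite /ray_tau ray_velocity0 ray0//; exact: hmap_dK. Qed.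

Lemma lambda_ray x v u : Kdom H x (u *: v) -> dfm_base H (ray H x v u) ->
  lambda H x (u *: v) (ray_tau x v u) = v.
Proof.
move=> Ku Xu; have D0 := phi_dom_r0 Ku Xu.
have pl s := @phi_ray _ _ _ H_close H_canonical x v u s Ku Xu.
have D0' : phi_dom H x (u *: v) (0 *: ray_tau x v u) by rewrite scale0r.
have [phd _] := is_diff_phi_r D0'.
have d1 := is_diff_comp (is_diff_scalel (0 : R) (ray_tau x v u)) (differentiableP phd).
have d2 : is_diff (0 : R) (fun s => phi H x (u *: v) (s *: ray_tau x v u)) (fun h => h *: v).
  have d3 : is_diff (0 : R) (fun s => (u + s) *: v) (fun h => h *: v).
    have := is_diff_scale (is_diffD (is_diff_cst u 0) (is_diff_id 0)) (is_diff_cst v 0).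
    by move=> /is_diff_eq; apply; rewrite funeqE => h /=; rewrite scaler0 addr0 add0r.
  apply: near_eq_is_diff d3.
  by have := near_phi_dom_line (ray_tau x v u) Ku Xu; apply: filterS => s Ds; rewrite pl.
have E := is_diff_line_unique d1 d2.
by rewrite scale0r in E.
Qed.

Lemma ray_tau_differentiable x v : dfm_base H x -> differentiable (ray_tau x v) 0.
Proof.
move=> Xx; have K0 : Kdom H x (0 *: v) by rewrite scale0r; exact: Kdom0.
have X0 : dfm_base H (ray H x v 0) by rewrite ray0.
by have [] := is_diff_comp (is_diff_pair (is_diff_ray K0) (is_diff_ray_velocity K0))
  (hmap_pair_differentiable (ray_velocity H x v 0) X0).
Qed.

Lemma gamma_ray x v : dfm_base H x ->
  gamma H x v v + derive1 (ray_tau x v) 0 = 0.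
Proof.
move=> Xx; have K0 : Kdom H x (0 *: v) by rewrite scale0r; exact: Kdom0.
have X0 : dfm_base H (ray H x v 0) by rewrite ray0.
have sd := is_diff_curve (ray_tau_differentiable v Xx).
have ld b : is_diff 0 (fun r : R => lambda H x (r *: v) b)
    ('d (fun t => lambda H x t b) 0 \o *:%R^~ v).
  have sv : is_diff (0 : R) ( *:%R^~ v) ( *:%R^~ v) by exact: is_diff_scalel.
  have lv : is_diff ((0 : R) *: v) (fun t => lambda H x t b)
      ('d (fun t => lambda H x t b) 0).
    by rewrite scale0r; exact/differentiableP/lambda_differentiable.
  exact: is_diff_comp sv lv.
pose L r := 'd (phi H x (r *: v)) (0 : V).
have Ld b : differentiable (fun r => L r b) 0 by have [] := ld b.
have f1 := is_diff_linear_family (rV_frame n) (L := L) Ld sd.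
have f2 : is_diff 0 (fun r => L r (ray_tau x v r))
   (fun h => 'd (fun t => lambda H x t v) 0 (h *: v) +
             L 0 (h *: derive1 (ray_tau x v) 0)).
  move: f1 => /is_diff_eq; apply; rewrite funeqE => h; congr (_ + _).
  by rewrite ray_tau0//; exact: (is_diffE h (ld v)).
have f3 : is_diff 0 (fun r => L r (ray_tau x v r)) (fun h => h *: 0).
  have -> : (fun h : R => h *: (0 : V)) = fun=> 0.
    by rewrite funeqE => h; rewrite scaler0.
  apply: near_eq_is_diff (is_diff_cst v 0).
  have := near_base_ray K0 X0; have := near_ray_dom K0.
  by apply: filterS2 => r Kr Xr; exact/esym/lambda_ray.
(* The remaining factor is [L 0], the derivative of phi_x(0, .), which is the identity. *)
apply: etrans (is_diff_curve_unique f2 f3); congr (_ + _).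
have p0 : is_diff (0 : V) (phi H x (0 *: v)) id.
  by rewrite scale0r; exact/is_diff_phi0/Kdom0.
exact: esym (is_diffE _ p0).
Qed.

(** In phi_x(r v, s tau_{e(r)}) = (r + s) v both arguments move with r; at r = 0 the first
    contributes mu and the second s times the derivative of tau. *)
Lemma mu_ray x v s : Kdom H x (s *: v) ->
  mu H x (s *: v) v = v - s *: derive1 (ray_tau x v) 0.
Proof.
move=> Ks; have Xx := Kdom_base Ks.
have K0 : Kdom H x (0 *: v) by rewrite scale0r; exact: Kdom0.
have X0 : dfm_base H (ray H x v 0) by rewrite ray0.
have D0 : phi_dom H x 0 (s *: v) by exact: phi_dom_l0.
set d := derive1 (ray_tau x v) 0.
have sd := is_diff_curve (ray_tau_differentiable v Xx).
have q0 : ((0 : R) *: v, s *: ray_tau x v 0) = (0, s *: v) by rewrite scale0r ray_tau0.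
have qd : is_diff (0 : R) (fun r => (r *: v, s *: ray_tau x v r))
    (fun h => h *: (v, s *: d)).
  have := is_diff_pair (is_diff_scalel (0 : R) v) (is_diffZ s sd).
  move=> /is_diff_eq; apply; rewrite funeqE => h; congr (_, _).
  by rewrite scalerA mulrC -scalerA.
have Pd := phi_pair_differentiable D0.
have f1 : is_diff (0 : R) (fun r => phi H x (r *: v) (s *: ray_tau x v r))
    (fun h => 'd (Phi x) (0, s *: v) (h *: (v, s *: d))).
  have Pd' : is_diff ((0 : R) *: v, s *: ray_tau x v 0) (Phi x) ('d (Phi x) (0, s *: v)).
    by rewrite q0; exact: differentiableP.
  exact: is_diff_comp qd Pd'.
have f2 : is_diff (0 : R) (fun r => phi H x (r *: v) (s *: ray_tau x v r))
    (fun h => h *: v).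
  have d3 : is_diff (0 : R) (fun r => (r + s) *: v) (fun h => h *: v).
    have := is_diff_scale (is_diffD (is_diff_id 0) (is_diff_cst s 0)) (is_diff_cst v 0).
    by move=> /is_diff_eq; apply; rewrite funeqE => h /=; rewrite scaler0 !addr0.
  apply: near_eq_is_diff d3.
  (* s need not be small: (0, s v) lies in the domain of phi_x, which is open, and r is close to
     0. *)
  have n1 : \forall r \near (0 : R), phi_dom H x (r *: v) (s *: ray_tau x v r).
    have qc : {for (0 : R), continuous (fun r => (r *: v, s *: ray_tau x v r))}.
      by have [qd' _] := qd; exact: differentiable_continuous.
    apply: (qc [set q | phi_dom H x q.1 q.2]); rewrite q0; exact: near_phi_dom.
  have := near_base_ray K0 X0; have := near_ray_dom K0.
  by apply: filterS3 n1 => r Dr Kr Xr; rewrite [RHS]phi_ray.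
have E := is_diff_line_unique f1 f2.
have El := is_diffE v (is_diff_phi_l D0).
(* phi_x(0, .) is the identity near s v, so the second partial derivative there is the identity
   too. *)
have Er : 'd (Phi x) (0, s *: v) (0, s *: d) = s *: d.
  exact: (is_diff_unique (s *: d) (is_diff_phi_r D0) (is_diff_phi0 Ks)).
have vs : (v, s *: d) = (v, 0) + (0, s *: d) by congr (_, _); rewrite /= ?addr0 ?add0r.
have Esum : 'd (Phi x) (0, s *: v) (v, s *: d) =
    'd (Phi x) (0, s *: v) (v, 0) + 'd (Phi x) (0, s *: v) (0, s *: d).
  by rewrite [X in 'd _ _ X]vs; exact: linearD.
apply: etrans El _.
have alg (A B C : V) : A + B = C -> B = s *: d -> A = C - s *: d.
  by move=> <- ->; rewrite addrK.
exact: alg (etrans (esym Esum) E) Er.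
Qed.

End RayIdentities.

Theorem mainTheorem2 (R : realType) (n : nat) (H : deformation R n)
    (H_close : close_points H) (H_canonical : canonical_deformation H)
    (x x' : 'rV[R]_n) (J : set R) (c : R -> 'rV[R]_n) (s : R)
    (xX : dfm_base H x) (x'X : dfm_base H x')
    (c_geodesic : geodesic H J c)
    (J0 : J 0) (c0 : c 0 = x) (Js : J s) (cs : c s = x') :
  mu H x (s *: tau H c 0) (tau H c 0) =
    tau H c 0 + s *: gamma H x (tau H c 0) (tau H c 0) /\
  lambda H x (s *: tau H c 0) (tau H c s) = tau H c 0.
Proof.
have [Ks csE dcsE] := geodesic_ray H_close H_canonical xX c_geodesic J0 c0 Js.
have tausE : tau H c s = ray_tau H x (tau H c 0) s.
  by rewrite /ray_tau -csE -dcsE.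
split.
  rewrite (mu_ray H_close H_canonical Ks).
  by rewrite -(addr0_eq (gamma_ray H_close H_canonical (tau H c 0) xX)) scalerN opprK.
rewrite tausE; apply: lambda_ray => //.
by rewrite -csE cs.
Qed.
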